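(* Let $k$ be any field, let $n$ and $d$ be integers with $n \geq 2d \geq 2$, and let $G = C_n(1,2,\ldots,d)$. Then the following are equivalent: (i) $G$ is Cohen-Macaulay (over $k$). (ii) $G$ is shellable. (iii) $G$ is vertex decomposable. (iv) $n \leq 3d+2$ and $n \neq 2d+2$.
   Context: Circulant graphs: given an integer $n \geq 1$ and $S \subseteq \{1,2,\ldots,\lfloor n/2 \rfloor\}$, the circulant graph $C_n(S)$ is the finite simple graph on vertices $\{x_1,\ldots,x_n\}$ such that $\{x_i,x_j\}$ (with $i \ne j$) is an edge if and only if $\min\{|i-j|,\, n-|i-j|\} \in S$. The set brackets are suppressed, so $C_n(1,2,\ldots,d) = C_n(\{1,2,\ldots,d\})$. Simplicial complexes: a simplicial complex $\Delta$ on a vertex set $V$ is a set of subsets of $V$ (its faces), containing $\emptyset$ and closed under taking subsets, with $\{x\} \in \Delta$ for every $x \in V$. Facets are the maximal faces under inclusion; $\dim F = |F|-1$; $\dim \Delta$ is the maximum dimension of its faces; $\Delta$ is pure if all facets have the same dimension. For $F \in \Delta$, $\mathrm{link}_\Delta(F) = \{H \in \Delta : F \cap H = \emptyset,\ F \cup H \in \Delta\}$; for a vertex $x$, $\mathrm{del}_\Delta(\{x\}) = \{F \in \Delta : x \notin F\}$. Links and deletions are regarded as complexes on the vertices that actually occur in them. Independence complex: for a finite simple graph $G$, $\mathrm{Ind}(G)$ is the simplicial complex of all independent sets of vertices of $G$ (sets containing no edge of $G$). Vertex decomposable: a pure simplicial complex $\Delta$ is vertex decomposable if either (a) $\Delta$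 is a simplex (its whole vertex set is its unique facet; this includes $\{\emptyset\}$), or (b) there is a vertex $x$ such that $\mathrm{link}_\Delta(\{x\})$ and $\mathrm{del}_\Delta(\{x\})$ are vertex decomposable (in particular pure). Shellable: a pure simplicial complex $\Delta$ is shellable if its facets can be ordered $F_1,\ldots,F_t$ such that for all $1 \leq j < i \leq t$ there are $x \in F_i \setminus F_j$ and $l \in \{1,\ldots,i-1\}$ with $\{x\} = F_i \setminus F_l$. Cohen-Macaulay graphs: for a graph $G$ on $\{x_1,\ldots,x_n\}$, let $R = k[x_1,\ldots,x_n]$ and let $I(G) = \langle x_ix_j : \{x_i,x_j\} \text{ is an edge of } G\rangle$ be the edge ideal (which is the Stanley-Reisner ideal of $\mathrm{Ind}(G)$). $G$ is Cohen-Macaulay if $R/I(G)$ is a Cohen-Macaulay ring, i.e. its Krull dimension equals its depth, where depth is the length of the longest regular sequence on $R/I(G)$ in $\langle x_1,\ldots,x_n\rangle$. $G$ is shellable (resp. vertex decomposable) if $\mathrm{Ind}(G)$ is shellable (resp. vertex decomposable). *)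

(* Defs.v *)
From HB Require Import structures.
From mathcomp Require Import all_boot all_order all_algebra.
From mathcomp Require Import generic_quotient ring_quotient.
From mathcomp Require Import mpoly.
From mathcomp Require Import boolp.

Set Implicit Arguments.
Unset Strict Implicit.
Unset Printing Implicit Defensive.

Import GRing.Theory.
Local Open Scope ring_scope.

Section Graphs.
Local Open Scope nat_scope.

(* The vertex x_(i+1) is i : 'I_n; only differences of indices matter. *)
Definition circulant (n : nat) (S : {pred nat}) : rel 'I_n :=
  fun i j =>
    let dist := `|i - j| in
    (i != j) && (minn dist (n - dist) \in S).

Lemma circulant_sym n S : ssrbool.symmetric (@circulant n S).
Proof. by move=> i j; rewrite /circulant /= eq_sym distnC. Qed.

Lemma circulant_irr n S : irreflexive (@circulant n S).
Proof. by move=> i; rewrite /circulant /= eqxx. Qed.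

Definition Ind (T : finType) (e : rel T) : {set {set T}} :=
  [set A : {set T} | [forall x in A, forall y in A, ~~ e x y]].

End Graphs.
Arguments circulant : clear implicits.

Section Complexes.
Local Open Scope nat_scope.
Variable T : finType.
Implicit Types (D : {set {set T}}) (F H A : {set T}) (x : T).

(* A complex is its set of faces; its vertex set is the union of its faces,
   so that links and deletions live on the vertices occurring in them. *)
Definition simplicial_complex D : Prop :=
  set0 \in D /\ forall F H, F \in D -> H \subset F -> H \in D.

Definition vertices D : {set T} := cover D.

Definition facets D : {set {set T}} := [set F | maxset (mem D) F].

(* As dim F = #|F| - 1, facets of equal dimension are facets of equal size. *)
Definition pure D : Prop := {in facets D &, forall F H, #|F| = #|H|}.

Definition link D F : {set {set T}} :=
  [set H in D | [disjoint F & H] && (F :|: H \in D)].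

Definition del D x : {set {set T}} := [set F in D | x \notin F].

Inductive vertex_decomposable D : Prop :=
| VDSimplex : pure D -> facets D = [set vertices D] -> vertex_decomposable D
| VDVertex x : pure D -> x \in vertices D ->
    vertex_decomposable (link D [set x]) -> vertex_decomposable (del D x) ->
    vertex_decomposable D.

Definition shellable D : Prop :=
  pure D /\
  exists2 Fs : seq {set T}, perm_eq Fs (enum (facets D)) &
    forall i j, j < i < size Fs ->
      exists x l, [/\ x \in nth set0 Fs i :\: nth set0 Fs j, l < i &
                      [set x] = nth set0 Fs i :\: nth set0 Fs l].

Lemma Ind_complex (e : rel T) : simplicial_complex (Ind e).
Proof.
split=> [|F H]; first by rewrite inE; apply/forall_inP=> x; rewrite inE.
rewrite !inE => /forall_inP Fe /subsetP HF.
apply/forall_inP=> x /HF/Fe/forall_inP xF; apply/forall_inP=> y /HF.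
exact: xF.
Qed.

Lemma link_complex D F :
  simplicial_complex D -> F \in D -> simplicial_complex (link D F).
Proof.
move=> [D0 DS] FD; split=> [|H K].
  by rewrite inE D0 setU0 FD disjoint_sym disjoints_subset sub0set.
rewrite !inE => /and3P[HD FH FHD] KH; rewrite (DS _ _ HD KH) /=.
by rewrite (disjointWr KH FH) (DS _ _ FHD) ?setUS.
Qed.

Lemma del_complex D x : simplicial_complex D -> simplicial_complex (del D x).
Proof.
move=> [D0 DS]; split=> [|F H]; first by rewrite !inE D0.
rewrite !inE => /andP[FD xF] HF; rewrite (DS _ _ FD HF) /=.
by apply: contra xF => /(subsetP HF).
Qed.

End Complexes.

Definition is_max (P : nat -> Prop) (r : nat) : Prop :=
  P r /\ forall r', P r' -> (r' <= r)%N.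

Section CommutativeAlgebra.
Variable A : comNzRingType.

(* The ideal generated by s; membership is turned into a boolean classically,
   as the ideals of ring_quotient are boolean predicates. *)
Definition ideal_gen (s : seq A) : {pred A} :=
  [pred a | `[< exists c : nat -> A, a = \sum_(i < size s) c i * s`_i >]].

Definition prime_chain (r : nat) : Prop :=
  exists p : 'I_r.+1 -> prime_idealr A,
    forall i j : 'I_r.+1, (i < j)%N ->
      {subset p i <= p j} /\ ~ {subset p j <= p i}.

Definition krull_dim : nat -> Prop := is_max prime_chain.

Definition regular_seq (s : seq A) : Prop :=
  1 \notin ideal_gen s /\
  forall i, (i < size s)%N -> forall a : A,
    s`_i * a \in ideal_gen (take i s) -> a \in ideal_gen (take i s).

End CommutativeAlgebra.

Section EdgeIdeals.
Variables (k : fieldType) (n : nat) (e : rel 'I_n).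

Definition edge_ideal : {pred {mpoly k[n]}} :=
  ideal_gen [seq 'X_(ij.1) * 'X_(ij.2)
            | ij <- enum [pred ij : 'I_n * 'I_n | e ij.1 ij.2]].

Lemma edge_ideal_closed : idealr_closed edge_ideal.
Proof.
split.
- apply/asboolP; exists (fun=> 0).
  by rewrite big1 // => i _; rewrite mul0r.
- apply/asboolP => -[c /(congr1 (meval (fun=> 0 : k)))] /eqP.
  rewrite rmorph1 rmorph_sum big1 ?oner_eq0 // => i _ /=.
  rewrite rmorphM /=.
  set s := (X in X`_i); have : s`_i \in s by rewrite mem_nth.
  by case/mapP=> ij _ ->; rewrite !rmorphM /= !mevalXU !mulr0.
- move=> a u v /asboolP[c ->] /asboolP[c' ->]; apply/asboolP.
  exists (fun i => a * c i + c' i).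
  by rewrite mulr_sumr -big_split; apply: eq_bigr => i _; rewrite mulrDl mulrA.
Qed.

HB.instance Definition _ := isIdealr.Build _ edge_ideal edge_ideal_closed.

Definition edge_ring : comNzRingType := {ideal_quot edge_ideal}.

Definition to_edge_ring : {mpoly k[n]} -> edge_ring :=
  \pi_({ideal_quot edge_ideal})%qT.

Definition max_ideal : {pred {mpoly k[n]}} := ideal_gen [seq 'X_i | i : 'I_n].

(* A polynomial f acts on R/I(G) as multiplication by its class. *)
Definition depth : nat -> Prop :=
  is_max (fun r => exists s : seq {mpoly k[n]},
    [/\ size s = r, {subset s <= max_ideal} &
        regular_seq (map to_edge_ring s)]).

Definition cohen_macaulay : Prop :=
  exists r, krull_dim edge_ring r /\ depth r.

End EdgeIdeals.
Arguments cohen_macaulay k {n} e.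
Arguments depth k {n} e.

(* Main.v *)
Require Import Defs.
From HB Require Import structures.
From mathcomp Require Import all_boot all_order all_algebra.
From mathcomp Require Import generic_quotient ring_quotient mpoly boolp ring zify.

(** Independent sets of C_n(1,...,d) are the sets with all cyclic gaps at least
    d + 1, and facets those whose gaps also are at most 2d + 1. Spreading s points
    evenly shows that facets of s points exist as soon as
    s (d + 1) <= n <= s (2d + 1), so for n >= 3d + 3 the complex is not pure, except
    when n = 4d + 3. For n = 2d + 2 the complex is a disjoint union of at least two
    edges, and for n = 4d + 3 it is 2-dimensional with a nonzero H^1. For the
    remaining n it consists of points or is a connected graph, which is vertex
    decomposable.

    A facet F gives a nonzero local cohomology class of degree #|F|, and a nonzero
    class in the reduced cohomology H^(p-1) gives one of degree p. These are represented
    in Koszul complexes of powers of the variables, and going down along connecting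
    maps they bound the length of regular sequences by their degree. The Krull
    dimension is the largest size of a face: a prime of k[x]/I contains all
    the x_i with i outside some face, and m + 1 polynomials in m variables are
    algebraically dependent. When the complex is a connected graph, the sum of the
    variables and the sum of the x_i x_j over its edges form a regular sequence. *)

Set Implicit Arguments.
Unset Strict Implicit.
Unset Printing Implicit Defensive.

Import GRing.Theory.
Local Open Scope ring_scope.

(** * Koszul cohomology and regular sequences *)

Section GeneratedIdeals.
Variable A : comNzRingType.
Implicit Types (s : seq A) (a b f : A).

Lemma ideal_genP s a :
  (a \in ideal_gen s) <-> exists c : nat -> A, a = \sum_(i < size s) c i * s`_i.
Proof. by split=> [/asboolP|?]; last apply/asboolP. Qed.

Lemma ideal_gen0 s : 0 \in ideal_gen s.
Proof. by apply/asboolP; exists (fun=> 0); rewrite big1 // => i _; rewrite mul0r. Qed.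

Lemma ideal_gen_lin s a b c :
  a \in ideal_gen s -> b \in ideal_gen s -> c * a + b \in ideal_gen s.
Proof.
move=> /asboolP[u ->] /asboolP[v ->]; apply/asboolP.
exists (fun i => c * u i + v i); rewrite mulr_sumr -big_split.
by apply: eq_bigr => i _; rewrite mulrDl mulrA.
Qed.

Lemma ideal_genD s a b :
  a \in ideal_gen s -> b \in ideal_gen s -> a + b \in ideal_gen s.
Proof. by move=> sa sb; rewrite -[a]mul1r ideal_gen_lin. Qed.

Lemma ideal_genM s a c : a \in ideal_gen s -> c * a \in ideal_gen s.
Proof. by move=> sa; rewrite -[c * a]addr0 ideal_gen_lin ?ideal_gen0. Qed.

Lemma ideal_genB s a b :
  a \in ideal_gen s -> b \in ideal_gen s -> a - b \in ideal_gen s.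
Proof. by move=> sa sb; rewrite addrC -mulN1r ideal_gen_lin. Qed.

Lemma ideal_gen_sum s (T : Type) (r : seq T) (P : pred T) (F : T -> A) :
  (forall i, P i -> F i \in ideal_gen s) -> \sum_(i <- r | P i) F i \in ideal_gen s.
Proof. by move=> sF; elim/big_ind: _ => //; [exact: ideal_gen0 | exact: ideal_genD]. Qed.

Lemma mem_ideal_gen s a : a \in s -> a \in ideal_gen s.
Proof.
move=> sa; apply/asboolP; exists (fun i => (i == index a s)%:R).
have si : (index a s < size s)%N by rewrite index_mem.
rewrite (bigD1 (Ordinal si)) //= eqxx mul1r nth_index // big1 ?addr0 // => i.
by rewrite -val_eqE => /negPf /= ->; rewrite mul0r.
Qed.

Lemma ideal_gen_map (T : finType) (F : T -> A) a :
  (a \in ideal_gen [seq F i | i : T]) <-> exists c : T -> A, a = \sum_i c i * F i.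
Proof.
split=> [/asboolP[c ->]|[c ->]]; last first.
  apply: ideal_gen_sum => i _; apply/ideal_genM/mem_ideal_gen.
  by apply/mapP; exists i; rewrite ?mem_enum.
have [/eqP T0|] := posnP #|T|.
  exists (fun=> 0); rewrite [RHS]big1 => [|i]; last by rewrite mul0r.
  by apply: big1 => -[i]; rewrite size_map -cardE (eqP T0).
case/card_gt0P=> t _; exists (fun i => c (index i (enum T))).
have -> (G : T -> A) : \sum_i G i = \sum_(i <- enum T) G i by rewrite big_enum.
rewrite (big_nth t) big_mkord size_map.
apply: eq_bigr => i _.
by rewrite index_uniq ?enum_uniq ?(nth_map t) -?enumT ?ltn_ord.
Qed.

Lemma ideal_gen_rcons s f a :
  (a \in ideal_gen (rcons s f)) <-> exists g, a - g * f \in ideal_gen s.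
Proof.
split=> [/asboolP[c ->]|[g /asboolP[c Dc]]].
  exists (c (size s)); apply/asboolP; exists c.
  rewrite size_rcons big_ord_recr /= nth_rcons ltnn eqxx addrK.
  by apply: eq_bigr => i _; rewrite nth_rcons ltn_ord.
apply/asboolP; exists (fun i => if (i < size s)%N then c i else g).
rewrite size_rcons big_ord_recr /= nth_rcons ltnn eqxx -[LHS](subrK (g * f)) Dc.
by congr (_ + _); apply: eq_bigr => i _; rewrite nth_rcons ltn_ord.
Qed.

Lemma ideal_gen_nil a : (a \in ideal_gen [::]) = (a == 0).
Proof.
apply/idP/eqP => [/asboolP[c ->]|->]; last exact: ideal_gen0.
by rewrite big_ord0.
Qed.

End GeneratedIdeals.

Section Koszul.
Variables (A : comNzRingType) (I : eqType).
Implicit Types (v w : I -> A) (c : seq I -> A) (s : seq I).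

(* Cochains are arbitrary, not necessarily alternating, functions of sequences.
   Contraction with [j], i.e. c |-> c (j :: -), is a homotopy between 0 and
   multiplication by [v j]: this is the second equation of the definition. *)
Fixpoint koszul v c s : A :=
  if s is j :: t then v j * c t - koszul v (fun u => c (j :: u)) t else 0.

Lemma koszulZ a v c s : koszul v (fun u => a * c u) s = a * koszul v c s.
Proof. by elim: s c => [|j s IH] c /=; rewrite ?mulr0 // IH; ring. Qed.

Lemma koszulD v c c' s :
  koszul v (fun u => c u + c' u) s = koszul v c s + koszul v c' s.
Proof. by elim: s c c' => [|j s IH] c c' /=; rewrite ?addr0 // IH; ring. Qed.

Lemma koszulB v c c' s :
  koszul v (fun u => c u - c' u) s = koszul v c s - koszul v c' s.
Proof. by elim: s c c' => [|j s IH] c c' /=; rewrite ?subr0 // IH; ring. Qed.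

Lemma koszul_koszul v c s : koszul v (koszul v c) s = 0.
Proof.
elim: s c => [|j s IH] c //=.
rewrite (koszulB v (fun u => v j * c u)) koszulZ IH; ring.
Qed.

Lemma koszul_anticomm v w c s :
  koszul v (koszul w c) s = - koszul w (koszul v c) s.
Proof.
elim: s c => [|j s IH] c /=; first by rewrite oppr0.
rewrite (koszulB v (fun u => w j * c u)) (koszulB w (fun u => v j * c u)).
rewrite !koszulZ IH; ring.
Qed.

Lemma koszul_scaled a v c s :
  koszul (fun i => a * v i) c s = koszul v (fun u => a * c u) s.
Proof. by elim: s c => [|j s IH] c //=; rewrite IH; ring. Qed.

Lemma koszul_sum (T : finType) (a : T -> A) (w : T -> I -> A) c s :
  koszul (fun i => \sum_t a t * w t i) c s = \sum_t a t * koszul (w t) c s.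
Proof.
elim: s c => [|j s IH] c /=; first by rewrite big1 // => t _; rewrite mulr0.
rewrite IH mulr_suml -sumrB; apply: eq_bigr => t _; ring.
Qed.

Lemma koszul_mem s v c t (s' := [seq v i | i <- s]) :
  {subset t <= s} -> koszul v c t \in ideal_gen s'.
Proof.
elim: t c => [|j t IH] c ts /=; first exact: ideal_gen0.
rewrite mulrC; apply: ideal_genB; last by apply: IH => i it; rewrite ts ?inE ?it ?orbT.
by apply/ideal_genM/mem_ideal_gen/map_f/ts; rewrite inE eqxx.
Qed.

Lemma koszul_ideal r v c p :
  (forall s, size s = p -> c s \in ideal_gen r) ->
  forall s, size s = p.+1 -> koszul v c s \in ideal_gen r.
Proof.
elim: p c => [|p IH] c rc [|j s] //= [ps].
  by move/size0nil: ps => -> /=; rewrite subr0 ideal_genM // rc.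
rewrite ideal_genB ?ideal_genM ?rc //; apply: IH ps => t pt.
by apply: rc; rewrite /= pt.
Qed.

(* The cochains are only meaningful in degree p, i.e. on sequences of size p. *)
Definition koszul_cocycle r v p c :=
  forall s, size s = p.+1 -> koszul v c s \in ideal_gen r.

Definition koszul_coboundary r v p c :=
  exists b, forall s, size s = p -> c s - koszul v b s \in ideal_gen r.

Lemma koszul_cocycleZ r v p c a :
  koszul_cocycle r v p c -> koszul_cocycle r v p (fun s => a * c s).
Proof. by move=> cc s ps; rewrite koszulZ ideal_genM ?cc. Qed.

Lemma koszul_coboundary_gen r v p c j :
  koszul_cocycle r v p c -> koszul_coboundary r v p (fun s => v j * c s).
Proof.
move=> cc; exists (fun t => c (j :: t)) => s ps.
by have /= := cc (j :: s); rewrite ps; apply.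
Qed.

Lemma koszul_coboundaryD r v p c c' :
  koszul_coboundary r v p c -> koszul_coboundary r v p c' ->
  koszul_coboundary r v p (fun s => c s + c' s).
Proof.
move=> [b bc] [b' bc']; exists (fun s => b s + b' s) => s ps.
by rewrite koszulD opprD addrACA ideal_genD ?bc ?bc'.
Qed.

Lemma koszul_coboundaryZ r v p c a :
  koszul_coboundary r v p c -> koszul_coboundary r v p (fun s => a * c s).
Proof.
move=> [b bc]; exists (fun s => a * b s) => s ps.
by rewrite koszulZ -mulrBr ideal_genM ?bc.
Qed.

End Koszul.

(** * Depth bounds from nonzero Koszul classes *)

Section DepthBound.
Variables (A : comNzRingType) (I : finType) (v : I -> A).
Implicit Types (r : seq A) (c : seq I -> A).

Lemma koszul_coboundary_ideal r p c f :
  koszul_cocycle r v p c -> f \in ideal_gen [seq v i | i : I] ->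
  koszul_coboundary r v p (fun s => f * c s).
Proof.
move=> cc /ideal_gen_map[a ->].
suff: koszul_coboundary r v p (fun s => \sum_i a i * v i * c s).
  by case=> b bc; exists b => s ps; rewrite mulr_suml bc.
elim: index_enum => [|i l [b bc]].
  exists (fun=> 0) => s ps; rewrite big_nil.
  by rewrite -[X in koszul v X](eq_fun (fun s => mul0r 0)) koszulZ mul0r subrr ideal_gen0.
have := koszul_coboundaryD (koszul_coboundaryZ (a i) (koszul_coboundary_gen i cc))
   (ex_intro _ b bc).
by case=> b' bc'; exists b' => s ps; rewrite big_cons -mulrA bc'.
Qed.

(* If f is regular modulo r, a cocycle killed by f in cohomology is the image of
   a cocycle of lower degree modulo r and f under the connecting map. *)
Lemma koszul_connecting r p c f :
  (forall a, f * a \in ideal_gen r -> a \in ideal_gen r) ->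
  koszul_cocycle r v p.+1 c -> koszul_coboundary r v p.+1 (fun s => f * c s) ->
  ~ koszul_coboundary r v p.+1 c ->
  exists2 b, koszul_cocycle (rcons r f) v p b &
    ~ koszul_coboundary (rcons r f) v p b.
Proof.
move=> f_reg cc [b bc] c_ncb; exists b => [s ps|[e ec]].
  apply/ideal_gen_rcons; exists (c s).
  by rewrite -[_ - _]opprB mulrC -mulN1r ideal_genM ?bc.
(* If [b] is d e + f g modulo [r], applying the differential d gives d b = f d g, while d b = f c by
   the choice of [b]. So f (c - d g) is 0 modulo [r], and [c] is the coboundary of [g] because [f]
   is regular. *)
have /choice[g Dg] s : exists a, size s = p -> b s - koszul v e s - f * a \in ideal_gen r.
  have [ps|nps] := size s =P p; last by exists 0.
  by have /ideal_gen_rcons[a Da] := ec s ps; exists a; rewrite mulrC.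
apply: c_ncb; exists g => s ps; apply: f_reg.
have := koszul_ideal v Dg ps.
rewrite (koszulB v (fun t => b t - koszul v e t)) koszulB koszul_koszul subr0.
by rewrite koszulZ => /(ideal_genD (bc s ps)); rewrite addrA subrK mulrBr.
Qed.

(** Each element of the sequence trades one degree: modulo it there is again a nonzero class, one
    degree lower. After [p] elements the class has degree 0, where only 0 is a coboundary, and a
    further element cannot be regular since a power of it kills the class. *)
Lemma koszul_depth s p c :
  regular_seq s ->
  (forall f, f \in s -> exists t, f ^+ t \in ideal_gen [seq v i | i : I]) ->
  koszul_cocycle [::] v p c -> ~ koszul_coboundary [::] v p c ->
  (size s <= p)%N.
Proof.
move=> [s_proper s_reg] s_rad cc c_ncb; rewrite leqNgt; apply/negP => ps.
suff /(_ p)[//|b bc b_ncb] q : (q <= p)%N ->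
    exists2 b, koszul_cocycle (take q s) v (p - q) b &
      ~ koszul_coboundary (take q s) v (p - q) b.
  rewrite subnn in bc b_ncb; apply: b_ncb; exists (fun=> 0) => u /size0nil -> /=.
  rewrite subr0; have [t] := s_rad _ (mem_nth 0 ps).
  move=> /(koszul_coboundary_ideal bc)[e /(_ [::] erefl)] /=; rewrite subr0.
  elim: t => [|t IH]; first by rewrite mul1r.
  by rewrite exprS -mulrA => /s_reg-/(_ ps).
elim: q => [|q IH] qp; first by exists c; rewrite ?subn0 ?take0.
have {IH} [b bc b_ncb] := IH (ltnW qp).
have qs : (q < size s)%N by lia.
rewrite (take_nth 0 qs); set f := s`_q.
have /asboolP ex_t : exists t, `[< koszul_coboundary (take q s) v (p - q) (fun u => f ^+ t * b u) >].
  have [t ft] := s_rad f (mem_nth 0 qs); exists t; apply/asboolP.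
  exact: koszul_coboundary_ideal.
(* The connecting map needs a class killed by [f] itself: for the least [t] such that [f ^+ t] kills
   the class of [b], take [f ^+ t.-1] times that class. *)
have {ex_t} [t t_cb t_min] := ex_minnP (asboolW ex_t).
case: t t_cb t_min => [|t] t_cb t_min.
  case: b_ncb; case/asboolP: t_cb => e ec; exists e => u /ec.
  by rewrite mul1r.
have pq : (p - q = (p - q.+1).+1)%N by lia.
rewrite pq in bc t_cb t_min.
apply: (koszul_connecting _ (koszul_cocycleZ (f ^+ t) bc)).
- by move=> a; apply: s_reg.
- by case/asboolP: t_cb => e ec; exists e => u /ec; rewrite exprS mulrA.
- by move/asboolP/t_min; rewrite ltnn.
Qed.

End DepthBound.

(** * The edge ring *)

Lemma IndP (T : finType) (e : rel T) (F : {set T}) :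
  reflect {in F &, forall x y, ~~ e x y} (F \in Ind e).
Proof.
rewrite inE; apply: (iffP forall_inP) => [Fe x y Fx Fy|Fe x Fx].
  by have /forall_inP := Fe x Fx; apply.
by apply/forall_inP => y; apply: Fe.
Qed.

Lemma IndS (T : finType) (e : rel T) (F H : {set T}) :
  H \subset F -> F \in Ind e -> H \in Ind e.
Proof. by move=> HF FI; have [_] := Ind_complex e; apply; first exact: FI. Qed.

Section Monomials.
Variable n : nat.
Implicit Types m u : 'X_{1..n}.

Definition vars m : {set 'I_n} := [set i | m i != 0%N].

Lemma varsD m u : vars (m + u) = vars m :|: vars u.
Proof. by apply/setP => i; rewrite !inE mnmDE addn_eq0 negb_and. Qed.

Lemma vars0 : vars 0 = set0.
Proof. by apply/setP => i; rewrite !inE mnm0E. Qed.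

Lemma vars1 i : vars U_(i) = [set i].
Proof. by apply/setP => j; rewrite !inE mnm1E eqb0 negbK eq_sym. Qed.

Lemma mcoeff_mulX (k : nzRingType) (p : {mpoly k[n]}) m u :
  (p * 'X_[u])@_m = if (u <= m)%MM then p@_(m - u) else 0.
Proof.
case: ifPn => [um|num]; first by rewrite -{1}(submK um) addmC mcoeffMX.
apply/eqP; rewrite mcoeff_eq0 (perm_mem (msuppMX _ _)).
by apply: contra num => /mapP[w _ ->]; exact: lem_addr.
Qed.

End Monomials.

Section EdgeRing.
Variables (k : fieldType) (n : nat) (e : rel 'I_n).
Hypothesis e_irr : irreflexive e.
Implicit Types (p q : {mpoly k[n]}) (m u : 'X_{1..n}) (F : {set 'I_n}).

Local Notation A := (edge_ring k e).
Local Notation pi := (@to_edge_ring k n e).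
Local Notation face m := (vars m \in Ind e).

HB.instance Definition _ := GRing.RMorphism.on pi.

(** The edge ideal is spanned by the monomials whose support contains an edge. Irreflexivity makes
    the ends of an edge distinct, so a monomial supported on both is divisible by the product of the
    two variables. *)
Lemma edge_idealP p :
  (p \in edge_ideal e) <-> (forall m, face m -> p@_m = 0).
Proof.
split=> [/asboolP[c ->] m /IndP fm|p0].
  rewrite raddf_sum big1 // => i _ /=.
  set s := (X in X`_i); have : s`_i \in s by rewrite mem_nth.
  case/mapP=> -[x y]; rewrite mem_enum inE /= => exy ->.
  rewrite -mpolyXD mcoeff_mulX; case: ifPn => // /mnm_lepP xym.
  suff [mx my] : x \in vars m /\ y \in vars m by have /negP[] := fm x y mx my.
  by split; rewrite inE -lt0n; [have := xym x | have := xym y];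
    rewrite mnmDE !mnm1E eqxx; lia.
rewrite [p]mpolyE; apply: ideal_gen_sum => m _.
have [/p0-> | ] := boolP (face m); first by rewrite scale0r ideal_gen0.
rewrite inE negb_forall_in => /exists_inP[x]; rewrite !inE => mx.
rewrite negb_forall_in => /exists_inP[y]; rewrite !inE negbK => my exy.
have xym : (U_(x) + U_(y) <= m)%MM.
  apply/mnm_lepP => j; rewrite mnmDE !mnm1E.
  have [<-|_] := eqVneq x j; last by have [<-|_] := eqVneq y j; lia.
  by have [yx|_] := eqVneq y x; [rewrite yx e_irr in exy | lia].
rewrite -(submK xym) mpolyXD -mul_mpolyC mulrA; apply/ideal_genM/mem_ideal_gen.
by apply/mapP; exists (x, y); rewrite ?mem_enum ?inE //= mpolyXD.
Qed.

Lemma eq_to_edge_ring p q : (pi p == pi q) = (p - q \in edge_ideal e).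
Proof. by rewrite Quotient.idealrBE. Qed.

Lemma to_edge_ring_ind (P : A -> Prop) : (forall p, P (pi p)) -> forall a, P a.
Proof. by move=> Ppi a; rewrite -[a]reprK; exact: Ppi. Qed.

(** Coordinate of [a] in the basis of face monomials. It is read off a chosen representative, so it
    is only meaningful when [m] is supported on a face. *)
Definition ecoef m (a : A) : k := (repr a)@_m.

Lemma ecoef_pi m p : face m -> ecoef m (pi p) = p@_m.
Proof.
move=> fm; apply/eqP; rewrite /ecoef -subr_eq0 -mcoeffB; apply/eqP.
by apply/edge_idealP: m fm; rewrite -eq_to_edge_ring; apply/eqP; exact: reprK.
Qed.

Lemma ecoefB m a b : face m -> ecoef m (a - b) = ecoef m a - ecoef m b.
Proof.
move=> fm; elim/to_edge_ring_ind: a => p; elim/to_edge_ring_ind: b => q.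
by rewrite -rmorphB !ecoef_pi // mcoeffB.
Qed.

Lemma ecoefD m a b : face m -> ecoef m (a + b) = ecoef m a + ecoef m b.
Proof.
move=> fm; elim/to_edge_ring_ind: a => p; elim/to_edge_ring_ind: b => q.
by rewrite -rmorphD !ecoef_pi // mcoeffD.
Qed.

Lemma ecoef0 m : face m -> ecoef m 0 = 0.
Proof. by move=> fm; rewrite -(rmorph0 pi) ecoef_pi // mcoeff0. Qed.

Lemma ecoef_sum m (T : Type) (r : seq T) (P : pred T) (F : T -> A) : face m ->
  ecoef m (\sum_(t <- r | P t) F t) = \sum_(t <- r | P t) ecoef m (F t).
Proof.
move=> fm; elim: r => [|t r IH]; first by rewrite !big_nil ecoef0.
by rewrite !big_cons; case: ifP; rewrite // ecoefD // IH.
Qed.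

Lemma ecoefMX m a u : face m ->
  ecoef m (a * pi 'X_[u]) = if (u <= m)%MM then ecoef (m - u) a else 0.
Proof.
move=> fm; elim/to_edge_ring_ind: a => p.
rewrite -rmorphM /= ecoef_pi // ?mcoeff_mulX; case: ifP => // um; rewrite ecoef_pi //.
by apply: IndS fm; rewrite -{2}(submK um) varsD subsetUl.
Qed.

Lemma ecoef_inj a b : (forall m, face m -> ecoef m a = ecoef m b) -> a = b.
Proof.
elim/to_edge_ring_ind: a => p; elim/to_edge_ring_ind: b => q eq_pq.
apply/eqP; rewrite eq_to_edge_ring; apply/edge_idealP => m fm.
by rewrite mcoeffB -!ecoef_pi // eq_pq // subrr.
Qed.

Definition edge_var i : A := pi 'X_i.

Lemma max_idealP p : p \in @max_ideal k n ->
  pi p \in ideal_gen [seq edge_var i | i : 'I_n].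
Proof.
move=> /ideal_gen_map[c ->]; apply/ideal_gen_map; exists (pi \o c).
by rewrite rmorph_sum; apply: eq_bigr => i _; rewrite rmorphM.
Qed.

Definition monom (s : seq 'I_n) : 'X_{1..n} := (\sum_(i <- s) U_(i))%MM.

Lemma vars_monom s : vars (monom s) = [set i in s].
Proof.
rewrite /monom; elim: s => [|i s IH].
  by rewrite big_nil vars0; apply/setP => j; rewrite !inE.
by rewrite big_cons varsD vars1 IH; apply/setP => j; rewrite !inE.
Qed.

Section Cohomology.
Implicit Types (psi : seq 'I_n -> k) (s t : seq 'I_n).

(** With all weights 1 the Koszul differential is the simplicial coboundary. Multiplying cochains by
    the monomial of their argument turns it into the Koszul differential of the variables. *)
Lemma koszul_monom psi t :
  koszul edge_var (fun s => pi (psi s *: 'X_[monom s])) t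
  = pi (koszul (fun=> 1) psi t *: 'X_[monom t]).
Proof.
elim: t psi => [|j t IH] psi /=; first by rewrite scale0r rmorph0.
have monom_cons s : 'X_[monom (j :: s)] = 'X_j * 'X_[monom s] :> {mpoly k[n]}.
  by rewrite /monom big_cons mpolyXD.
have -> : (fun s => pi (psi (j :: s) *: 'X_[monom (j :: s)]))
  = (fun s => edge_var j * pi (psi (j :: s) *: 'X_[monom s])).
  by apply: funext => s; rewrite monom_cons -rmorphM scalerAr.
rewrite koszulZ (IH (fun s => psi (j :: s))) -!rmorphM -rmorphB -!scalerAr.
by rewrite -scalerBl monom_cons mul1r.
Qed.

(** The Koszul differential of the variables preserves multidegrees, and in a fixed multidegree it
    is the simplicial coboundary. The shift [u] absorbs the head of the sequence in the
    induction. *)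
Lemma ecoef_koszul b t u : face (u + monom t) ->
  ecoef (u + monom t) (koszul edge_var b t)
  = koszul (fun=> 1) (fun s => ecoef (u + monom s) (b s)) t.
Proof.
elim: t b u => [|j t IH] b u; first exact: ecoef0.
rewrite /monom big_cons -/(monom t) => f_ujt.
have f_ut : face (u + monom t).
  by apply: IndS f_ujt; rewrite !varsD setUS ?subsetUr.
rewrite /= ecoefB // mulrC ecoefMX // mul1r.
have -> : (U_(j) <= u + (U_(j) + monom t))%MM.
  by apply/mnm_lepP => i; rewrite !mnmDE; lia.
have uj_t : (u + (U_(j) + monom t) = (u + U_(j)) + monom t)%MM by rewrite addmA.
congr (ecoef _ _ - _).
  by apply/mnmP => i; rewrite -/(monom t) mnmBE !mnmDE; lia.
rewrite uj_t IH -?uj_t //; congr koszul; apply: funext => s.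
by rewrite /monom big_cons addmA.
Qed.

(** On sequences of [d] vertices, [psi] is a cocycle for reduced cohomology in degree d - 1.
    Weighted by monomials it is a Koszul cocycle of degree [d], and the coefficients of a Koszul
    primitive in the same multidegree would give a simplicial primitive. *)
Lemma cohomology_depth d psi (s : seq {mpoly k[n]}) :
  regular_seq (map pi s) -> {subset s <= @max_ideal k n} ->
  (forall t, size t = d.+1 -> [set i in t] \in Ind e -> koszul (fun=> 1) psi t = 0) ->
  ~ (exists b, forall t, size t = d -> [set i in t] \in Ind e ->
       koszul (fun=> 1) b t = psi t) ->
  (size s <= d)%N.
Proof.
move=> s_reg s_max psi_cocycle psi_ncb; rewrite -(size_map pi).
apply: (koszul_depth (v := edge_var) (c := fun t => pi (psi t *: 'X_[monom t]))) => //.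
- move=> _ /mapP[f sf ->]; exists 1%N; exact: max_idealP (s_max f sf).
- move=> t td; rewrite ideal_gen_nil koszul_monom -(rmorph0 pi) eq_to_edge_ring subr0.
  apply/edge_idealP => m fm; rewrite mcoeffZ mcoeffX.
  have [mt|_] := eqVneq (monom t) m; last by rewrite mulr0.
  by rewrite psi_cocycle ?mul0r // -vars_monom mt.
- case=> b psi_b; apply: psi_ncb; exists (fun t => ecoef (monom t) (b t)) => t td ft.
  have fmt : face (0 + monom t) by rewrite add0m vars_monom.
  have /= := psi_b t td; rewrite ideal_gen_nil subr_eq0 => /eqP/(congr1 (ecoef (0 + monom t))).
  rewrite ecoef_pi // ecoef_koszul // mcoeffZ mcoeffX add0m eqxx mulr1 => ->.
  by congr koszul; apply: funext => u; rewrite add0m.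
Qed.

End Cohomology.
End EdgeRing.

(** * Exterior monomials in the Koszul complex *)

Section ExteriorMonomials.
Variables (A : comNzRingType) (I : eqType).
Implicit Types (v : I -> A) (c : seq I -> A) (s l : seq I).

Definition dirac (i j : I) : A := (i == j)%:R.

(** The Koszul differential is the exterior product with the sum of the v_j e_j, so
    [koszul (dirac i)] multiplies by e_i, and this is the coefficient function of the product of the
    e_i for [i] in [l]. *)
Fixpoint exterior l : seq I -> A :=
  if l is i :: l' then koszul (dirac i) (exterior l') else fun s => (s == [::])%:R.

Lemma koszul_dirac_notin i c s : i \notin s -> koszul (dirac i) c s = 0.
Proof.
elim: s c => [|j s IH] c //=; rewrite inE negb_or => /andP[/negPf ij si].
by rewrite /dirac ij mul0r IH // subr0.
Qed.

Lemma exterior_diag l : uniq l -> exterior l l = 1.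
Proof.
elim: l => [|i l IH] //= /andP[il l_uniq].
by rewrite koszul_dirac_notin // IH // /dirac eqxx mul1r subr0.
Qed.

Lemma koszul_exterior i l s : i \in l -> koszul (dirac i) (exterior l) s = 0.
Proof.
elim: l s => [|j l IH] s //=; rewrite inE.
have [<- _|ij /= il] := eqVneq i j; first exact: koszul_koszul.
rewrite koszul_anticomm (_ : koszul (dirac i) _ = fun t => 0 * exterior l t).
  by rewrite koszulZ mul0r oppr0.
by apply: funext => t; rewrite mul0r IH.
Qed.

End ExteriorMonomials.

Section Radical.
Variables (A : comNzRingType) (r : seq A).

Lemma radicalD a b :
  (exists t, a ^+ t \in ideal_gen r) -> (exists t, b ^+ t \in ideal_gen r) ->
  exists t, (a + b) ^+ t \in ideal_gen r.
Proof.
move=> [p ap] [q bq]; exists (p + q)%N; rewrite exprDn.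
apply: ideal_gen_sum => i _; rewrite -mulr_natl; apply: ideal_genM.
have [qi|iq] := leqP q i.
  by rewrite -{2}(subnK qi) exprD mulrA ideal_genM.
have -> : (p + q - i = (q - i) + p)%N by lia.
by rewrite exprD mulrAC ideal_genM.
Qed.

Lemma radical_gen (T : finType) (x : T -> A) f :
  (forall i, exists t, x i ^+ t \in ideal_gen r) ->
  f \in ideal_gen [seq x i | i : T] -> exists t, f ^+ t \in ideal_gen r.
Proof.
move=> x_rad /ideal_gen_map[c ->]; elim/big_ind: _ => [||i _].
- by exists 1%N; exact: ideal_gen0.
- exact: radicalD.
- by have [t xt] := x_rad i; exists t; rewrite exprMn ideal_genM.
Qed.

End Radical.

Lemma facet_extend (T : finType) (e : rel T) (F : {set T}) j :
  F \in facets (Ind e) -> j \notin F -> j |: F \notin Ind e.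
Proof.
rewrite inE => /maxsetP[_ F_max]; apply: contra => jF.
by rewrite -(F_max (j |: F)) ?setU11 ?subsetUr.
Qed.

Lemma monomE n (s : seq 'I_n) j : monom s j = count_mem j s.
Proof.
rewrite /monom; elim: s => [|i s IH]; first by rewrite big_nil mnm0E.
by rewrite big_cons mnmDE mnm1E IH.
Qed.

Section FacetDepth.
Variables (k : fieldType) (n : nat) (e : rel 'I_n).
Hypothesis e_irr : irreflexive e.

Local Notation A := (edge_ring k e).
Local Notation pi := (@to_edge_ring k n e).
Local Notation x := (@edge_var k n e).

(* The class x_F e_F / x_F^2 of the local cohomology in degree -F, seen in the
   Koszul complex of the squares of the variables. *)
Lemma facet_depth F (s : seq {mpoly k[n]}) :
  F \in facets (Ind e) -> regular_seq (map pi s) ->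
  {subset s <= @max_ideal k n} -> (size s <= #|F|)%N.
Proof.
move=> F_facet s_reg s_max; rewrite -(size_map pi) cardE.
have FI : F \in Ind e by move: F_facet; rewrite inE => /maxsetP[].
set xF := pi 'X_[monom (enum F)].
have vF : vars (monom (enum F)) = F by rewrite vars_monom set_enum.
pose y i := x i ^+ 2.
have xF_y i : i \notin F -> xF * y i = 0.
  move=> iF; rewrite /xF /y /edge_var -rmorphXn -rmorphM -(rmorph0 pi); apply/eqP.
  rewrite eq_to_edge_ring subr0; apply/edge_idealP => // m fm.
  rewrite expr2 -!mpolyXD mcoeffX; have [mE|//] := eqVneq.
  by move: fm (facet_extend F_facet iF); rewrite -mE !varsD vars1 setUid vF setUC => ->.
pose c t := xF * exterior A (enum F) t.
apply: (koszul_depth (v := y) (c := c)) => //.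
- move=> _ /mapP[f sf ->]; apply: (radical_gen _ (max_idealP _ (s_max f sf))) => i.
  by exists 2%N; apply/mem_ideal_gen/map_f; rewrite mem_enum.
(* [xF] kills the y_j with [j] outside [F], and for [j] in [F] the factor e_j already occurs in the
   exterior monomial, so every term of the differential vanishes. *)
- move=> t _; rewrite ideal_gen_nil -koszul_scaled.
  rewrite (_ : (fun i => _) = fun i => \sum_j (xF * y j) * dirac A j i).
    rewrite koszul_sum big1 // => j _; have [jF|/xF_y->] := boolP (j \in F).
      by rewrite koszul_exterior ?mulr0 // mem_enum.
    by rewrite mul0r.
  apply: funext => i; rewrite (bigD1 i) //= big1 => [|j /negPf ji].
    by rewrite /dirac eqxx mulr1 addr0.
  by rewrite /dirac ji mulr0.
(* Evaluated at [enum F], a primitive would put the squarefree [xF] in the ideal of the squares of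
   the variables of [F]. *)
- case=> b /(_ (enum F) erefl); rewrite ideal_gen_nil /c exterior_diag ?enum_uniq //.
  rewrite mulr1 subr_eq0 => /eqP xF_b.
  have := koszul_mem y b (fun i => id) : koszul y b (enum F) \in _.
  rewrite -xF_b => /ideal_genP[a].
  move/(congr1 (ecoef (monom (enum F)))); rewrite ecoef_pi ?vF // mcoeffX eqxx.
  rewrite ecoef_sum ?vF // big1 => [/eqP|i _]; first by rewrite oner_eq0.
  set z := (X in _ * X); have : z \in [seq y j | j <- enum F] by rewrite mem_nth.
  case/mapP=> j _ ->; rewrite /y /edge_var -rmorphXn /= expr2 -mpolyXD ecoefMX ?vF //.
  case: ifP => // /mnm_lepP/(_ j); rewrite mnmDE mnm1E eqxx monomE.
  by rewrite count_uniq_mem ?enum_uniq //; case: (_ \in _).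
Qed.
End FacetDepth.

(** * Krull dimension *)

Section Restriction.
Variables (k : fieldType) (n : nat).
Implicit Types (p q : {mpoly k[n]}) (m : 'X_{1..n}) (F : {set 'I_n}).

Definition restrict F : {mpoly k[n]} -> {mpoly k[n]} :=
  comp_mpoly [tuple if i \in F then 'X_i else 0 | i < n].

HB.instance Definition _ F := GRing.RMorphism.on (restrict F).

Lemma restrictX F m :
  restrict F 'X_[m] = if vars m \subset F then 'X_[m] else 0.
Proof.
rewrite /restrict comp_mpolyX; case: ifPn => [/subsetP mF|/subsetPn[i im iF]].
  rewrite mpolyXE_id; apply: eq_bigr => i _; rewrite tnth_mktuple.
  have [->|mi] := eqVneq (m i) 0%N; first by rewrite !expr0.
  by rewrite mF // inE.
rewrite (bigD1 i) //= tnth_mktuple (negPf iF) expr0n; move: im; rewrite inE.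
by move=> /negPf->; rewrite mul0r.
Qed.

Lemma mcoeff_restrict F p m :
  (restrict F p)@_m = if vars m \subset F then p@_m else 0.
Proof.
elim/mpolyind: p => [|c u p _ _ IH]; first by rewrite rmorph0 mcoeff0 if_same.
rewrite /restrict comp_mpolyD comp_mpolyZ -/(restrict F) restrictX !mcoeffD IH.
rewrite !mcoeffZ (fun_if (mcoeff m)) mcoeff0 mcoeffX.
have [->|_] := eqVneq u m; last by rewrite if_same mulr0 !add0r.
by case: ifP => _; rewrite ?mulr0 ?addr0.
Qed.

Lemma restrict_eq0 F p :
  (restrict F p == 0) <-> (forall m, vars m \subset F -> p@_m = 0).
Proof.
split=> [/eqP p0 m mF|p0]; first by rewrite -(mcoeff0 k m) -p0 mcoeff_restrict mF.
by apply/eqP/mpolyP => m; rewrite mcoeff_restrict mcoeff0; case: ifP => // /p0.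
Qed.

End Restriction.

Section KrullLowerBound.
Variables (k : fieldType) (n : nat) (e : rel 'I_n).
Hypothesis e_irr : irreflexive e.

Local Notation A := (edge_ring k e).
Local Notation pi := (@to_edge_ring k n e).

Section FacePrime.
Variables (F : {set 'I_n}) (FI : F \in Ind e).

Definition face_prime of F \in Ind e : {pred A} :=
  [pred a | restrict F (repr a) == 0].

Lemma mem_face_prime p : (pi p \in face_prime FI) = (restrict F p == 0).
Proof.
rewrite inE; suff /eqP: restrict F (p - repr (pi p)) == 0.
  by rewrite rmorphB => /eqP; rewrite subr_eq0 => /eqP->.
apply/restrict_eq0 => m mF.
have /edge_idealP : p - repr (pi p) \in edge_ideal e.
  by rewrite -eq_to_edge_ring; apply/eqP/esym; exact: reprK.
by apply=> //; exact: IndS FI.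
Qed.

Lemma face_prime_idealr : idealr_closed (face_prime FI).
Proof.
split; first by rewrite -(rmorph0 pi) mem_face_prime rmorph0.
  by rewrite -(rmorph1 pi) mem_face_prime rmorph1 oner_eq0.
move=> a u v; elim/to_edge_ring_ind: a => a; elim/to_edge_ring_ind: u => u.
elim/to_edge_ring_ind: v => v; rewrite -rmorphM -rmorphD !mem_face_prime.
by move=> /eqP u0 /eqP v0; rewrite rmorphD rmorphM /= u0 v0 mulr0 addr0.
Qed.

HB.instance Definition _ := isIdealr.Build A (face_prime FI) face_prime_idealr.

Lemma face_prime_prime : prime_idealr_closed (face_prime FI).
Proof.
move=> u v; elim/to_edge_ring_ind: u => u; elim/to_edge_ring_ind: v => v.
by rewrite -rmorphM !mem_face_prime rmorphM mulf_eq0.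
Qed.

HB.instance Definition _ :=
  isPrimeIdealrClosed.Build A (face_prime FI) face_prime_prime.

End FacePrime.

(** Removing the vertices of [F] one at a time gives decreasing faces, hence increasing primes. The
    variable [x] removed just after the [i]-th face lies in all later primes but not in the
    [i]-th. *)
Lemma face_prime_chain F : F \in Ind e -> prime_chain A #|F|.
Proof.
move=> FI; pose G i := [set x in take (#|F| - i) (enum F)].
have GI i : G i \in Ind e.
  by apply: IndS FI; apply/subsetP => x; rewrite inE => /mem_take; rewrite mem_enum.
exists (fun i => face_prime (GI i) : prime_idealr A) => i j ij.
have jF : (j <= #|F|)%N by rewrite -ltnS.
split.
  move=> a; elim/to_edge_ring_ind: a => p; rewrite !mem_face_prime.
  move=> /restrict_eq0 p0; apply/restrict_eq0 => m /subsetP mG; apply: p0.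
  apply/subsetP => x /mG; rewrite !inE.
  rewrite -[in X in _ -> X](subnKC (_ : #|F| - j <= #|F| - i)%N); last by lia.
  by rewrite takeD mem_cat => ->.
have [x0 _] : exists x0, x0 \in F by apply/card_gt0P; lia.
have nF : (#|F| - i.+1 < size (enum F))%N by rewrite -cardE; lia.
pose x := nth x0 (enum F) (#|F| - i.+1).
move=> /(_ (pi 'X_x)); rewrite !mem_face_prime !restrictX !vars1 !sub1set !inE.
have -> : x \in take (#|F| - i) (enum F).
  have -> : (#|F| - i = (#|F| - i.+1).+1)%N by lia.
  by rewrite (take_nth x0) // mem_rcons inE eqxx.
have -> : x \in take (#|F| - j) (enum F) = false.
  apply: contraTF (enum_uniq (mem F)) => x_j; rewrite -(cat_take_drop (#|F| - j) (enum F)).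
  rewrite cat_uniq negb_and negb_and; apply/orP; right; apply/orP; left.
  rewrite negbK; apply/hasP; exists x => //.
  have -> : x = nth x0 (drop (#|F| - j) (enum F)) (j - i.+1).
    by rewrite nth_drop /x; congr nth; lia.
  by rewrite mem_nth // size_drop -cardE; lia.
move=> /(_ (eqxx _))/eqP/(congr1 (mcoeff U_(x)))/eqP.
by rewrite mcoeffX eqxx mcoeff0 oner_eq0.
Qed.

End KrullLowerBound.

(** * Algebraic dependence of many polynomials in few variables *)

Section PolynomialRelations.
Variables (k : fieldType) (n N : nat).
Implicit Types (p q : {mpoly k[n]}) (ps : seq {mpoly k[n]}) (c : seq nat -> k).
Implicit Types (m : 'X_{1..n}) (F : {set 'I_n}).

(* The value at ps of the polynomial whose coefficient at the exponent s is c s,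
   for s with entries less than N. *)
Fixpoint relation ps c : {mpoly k[n]} :=
  if ps is p :: qs then \sum_(j < N) p ^+ j * relation qs (fun s => c (nat_of_ord j :: s))
  else (c [::])%:MP.

Definition nontrivial r c :=
  exists s, [/\ size s = r, all (fun j => j < N)%N s & c s != 0].

Fixpoint power ps (s : seq nat) : {mpoly k[n]} :=
  if ps is p :: qs then p ^+ head 0%N s * power qs (behead s) else 1.

Fixpoint exponents r : seq (seq nat) :=
  if r is r'.+1 then [seq j :: s | j <- iota 0 N, s <- exponents r'] else [:: [::]].

Lemma size_exponents r : size (exponents r) = (N ^ r)%N.
Proof. by elim: r => //= r IH; rewrite size_allpairs size_iota IH expnS. Qed.

Lemma exponents_uniq r : uniq (exponents r).
Proof.
elim: r => //= r IH; apply: allpairs_uniq; rewrite ?iota_uniq //.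
by move=> [i s] [j t] _ _ [-> ->].
Qed.

Lemma exponentsP r s :
  s \in exponents r -> size s = r /\ all (fun j => j < N)%N s.
Proof.
elim: r s => [|r IH] s /=; first by rewrite inE => /eqP->.
case/allpairsP=> -[j t] [/= jN /IH[<- tN] ->]; split=> //=.
by rewrite tN andbT; rewrite mem_iota in jN.
Qed.

Lemma relationE ps c :
  relation ps c = \sum_(s <- exponents (size ps)) c s *: power ps s.
Proof.
elim: ps c => [|p ps IH] c /=.
  by rewrite big_seq1 -mul_mpolyC mulr1.
have -> : iota 0 N = index_iota 0 N by rewrite /index_iota subn0.
rewrite big_allpairs_dep big_mkord; apply: eq_bigr => j _.
by rewrite IH mulr_sumr; apply: eq_bigr => s _; rewrite -scalerAr.
Qed.

Definition inbox F B p := forall m, p@_m != 0 -> vars m \subset F /\ (mdeg m <= B)%N.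

Lemma inbox1 F : inbox F 0 1.
Proof.
move=> m; rewrite mcoeff1; have [->|_] := eqVneq m 0%MM; last by rewrite eqxx.
by rewrite vars0 sub0set mdeg0.
Qed.

Lemma inboxM F B C p q : inbox F B p -> inbox F C q -> inbox F (B + C) (p * q).
Proof.
move=> pB qC m; rewrite -mcoeff_msupp => /msuppM_le/allpairsP[[u w] /= [pu qw ->]].
rewrite !mcoeff_msupp in pu qw.
have [uF uB] := pB u pu; have [wF wC] := qC w qw.
by rewrite varsD subUset uF wF mdegD leq_add.
Qed.

Lemma inboxX F B p j : inbox F B p -> inbox F (B * j) (p ^+ j).
Proof.
move=> pB; elim: j => [|j IH]; first by rewrite muln0; exact: inbox1.
by rewrite mulnS exprS; apply: inboxM.
Qed.

Lemma inbox_leq F B C p : (B <= C)%N -> inbox F B p -> inbox F C p.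
Proof. by move=> BC pB m /pB[mF mB]; split=> //; exact: leq_trans BC. Qed.

Lemma inbox_power F D ps s :
  {in ps, forall p, inbox F D p} -> size s = size ps ->
  all (fun j => j < N)%N s -> inbox F (D * (size ps * N)) (power ps s).
Proof.
elim: ps s => [|p ps IH] [|j s] //= psD; first by rewrite mul0n muln0 => _ _; exact: inbox1.
move=> [sps] /andP[jN sN].
apply: (@inbox_leq _ (D * j + D * (size ps * N))); first by nia.
apply: inboxM; first by apply/inboxX/psD; rewrite inE eqxx.
by apply: IH => // q qps; apply: psD; rewrite inE qps orbT.
Qed.

End PolynomialRelations.

Section AlgebraicDependence.
Variables (k : fieldType) (n : nat).
Implicit Types (ps : seq {mpoly k[n]}) (F : {set 'I_n}).

Definition box_monom F B (g : {ffun {i | i \in F} -> 'I_B.+1}) : 'X_{1..n} :=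
  [multinom (if insub i is Some u then nat_of_ord (g u) else 0%N) | i < n].

Lemma box_monom_surj F B (m : 'X_{1..n}) :
  vars m \subset F -> (mdeg m <= B)%N -> exists g : {ffun _ -> 'I_B.+1}, m = @box_monom F B g.
Proof.
move=> /subsetP mF mB; exists [ffun u => inord (m (val u))].
apply/mnmP => i; rewrite mnmE; case: insubP => [u _ <-|iF].
  rewrite ffunE inordK // ltnS; apply: leq_trans mB.
  by rewrite mdegE (bigD1 (val u)) //= leq_addr.
by apply/eqP; apply: contraNT iF => mi; apply: mF; rewrite inE.
Qed.

(* There are N ^ r products of powers less than N, and they lie in the span of
   fewer monomials once N is large. *)
Lemma algebraic_dependence F ps :
  {in ps, forall p (m : 'X_{1..n}), p@_m != 0 -> vars m \subset F} ->
  (#|F| < size ps)%N ->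
  exists N c, nontrivial N (size ps) c /\ relation N ps c = 0.
Proof.
move=> psF Fps; pose r := size ps; pose D := (\sum_(p <- ps) msize p)%N.
have psD : {in ps, forall p, inbox F D p}.
  move=> p pps m pm; split; first exact: psF pm.
  rewrite -mcoeff_msupp in pm; apply: leq_trans (ltnW (msize_mdeg_lt pm)) _.
  by rewrite /D (big_rem p) //= leq_addr.
(* There are at most ((D r + 1) N)^#|F| = K N^#|F| box monomials, fewer than N^(#|F| + 1), hence
   fewer than the N^r products of powers. *)
pose K := ((D * r).+1 ^ #|F|)%N; pose N := K.+1; pose B := (D * (r * N))%N.
pose T := {ffun {i | i \in F} -> 'I_B.+1}.
have cardT : (#|{: T}| < N ^ r)%N.
  rewrite card_ffun card_ord card_sig.
  have -> : #|[pred x in F]| = #|F| by apply: eq_card.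
  have BN : (B.+1 <= (D * r).+1 * N)%N by rewrite /B; nia.
  have {}BN : (B.+1 ^ #|F| <= ((D * r).+1 * N) ^ #|F|)%N.
    by case: #|F| => [|f]; rewrite ?expn0 // leq_exp2r.
  apply: leq_ltn_trans BN _.
  rewrite expnMn -/K; apply: (@leq_trans (N ^ #|F|.+1)); last by rewrite leq_pexp2l.
  by rewrite expnS ltn_mul2r expn_gt0 /N /= leqnn.
pose M : 'M[k]_(N ^ r, #|{: T}|) :=
  \matrix_(i, j) (power ps (nth [::] (exponents N r) i))@_(box_monom (enum_val j)).
have [v vM v0] : exists2 v : 'rV_(N ^ r), v *m M = 0 & v != 0.
  have : kermx M != 0.
    rewrite -mxrank_eq0 mxrank_ker subn_eq0 -ltnNge.
    by apply: leq_ltn_trans cardT; exact: rank_leq_col.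
  by case/rowV0Pn=> v /sub_kermxP; exists v.
exists N, (fun s => if insub (index s (exponents N r)) is Some i then v 0 i else 0).
have nth_exp (i : 'I_(N ^ r)) : (i < size (exponents N r))%N by rewrite size_exponents.
split.
  have [i vi] : exists i, v 0 i != 0.
    apply/existsP; apply: contraNT v0; rewrite negb_exists => /forallP v0.
    by apply/eqP/rowP => i; rewrite mxE; apply/eqP; rewrite -[_ == _]negbK v0.
  exists (nth [::] (exponents N r) i).
  have [? ?] := exponentsP (mem_nth [::] (nth_exp i)); split=> //.
  by rewrite index_uniq ?exponents_uniq // valK.
apply/mpolyP => m; rewrite mcoeff0 relationE raddf_sum /= -/r.
pose G i := power ps (nth [::] (exponents N r) i).
rewrite (big_nth [::]) size_exponents big_mkord.
rewrite (eq_bigr (fun i : 'I_(N ^ r) => v 0 i * (G i)@_m)); last first.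
  by move=> i _; rewrite mcoeffZ index_uniq ?exponents_uniq // valK.
have [m0|] := boolP [forall i : 'I_(N ^ r), (G i)@_m == 0].
  by rewrite big1 // => i _; rewrite (eqP (forallP m0 i)) mulr0.
rewrite negb_forall => /existsP[i mi].
have [iN ri] := exponentsP (mem_nth [::] (nth_exp i)).
have [mF mB] := inbox_power psD iN ri mi.
have [g mE] := box_monom_surj mF mB.
move/rowP/(_ (enum_rank g)): vM; rewrite !mxE => vg.
rewrite -[RHS]vg; apply: eq_bigr => j _.
by rewrite mxE enum_rankK -mE.
Qed.

End AlgebraicDependence.

Section KrullUpperBound.
Variables (k : fieldType) (n : nat) (e : rel 'I_n).
Local Notation A := (edge_ring k e).
Local Notation pi := (@to_edge_ring k n e).

(* Factoring out the lowest power of the first element, whose cofactor must vanish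
   modulo the next prime ideal of the chain. *)
Lemma relation_notin_prime N (ps : seq {mpoly k[n]}) (P : nat -> prime_idealr A) c :
  (forall i, (i < size ps)%N ->
     [/\ {subset P i <= P i.+1}, pi ps`_i \in P i.+1 & pi ps`_i \notin P i]) ->
  nontrivial N (size ps) c -> pi (relation N ps c) \notin P 0%N.
Proof.
elim: ps P c => [|p ps IH] P c chain [s [sps sN cs]].
  move: cs; rewrite (size0nil sps) /= => c0; apply/negP => cP.
  have : pi ((c [::])^-1)%:MP * pi (c [::])%:MP \in P 0%N by rewrite idealMr.
  by rewrite -rmorphM -mpolyCM mulVf // rmorph1 idealr1.
have [P01 pP1 pP0] := chain 0%N isT.
pose shifted j := nontrivial N (size ps) (fun t => c (j :: t)).
have [j0 j0N sj0] : exists2 j, (j < N)%N & shifted j.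
  case: s sps sN cs => // j s [sps] /andP[jN sN] cs.
  by exists j => //; exists s.
have ex_j : exists j, `[< shifted j >] by exists j0; apply/asboolP.
have [j /asboolP sj j_min] := ex_minnP ex_j.
have jN : (j < N)%N by apply: leq_ltn_trans j0N; apply/j_min/asboolP.
pose g i := relation N ps (fun t => c (i :: t)).
have g0 i : (i < j)%N -> g i = 0.
  move=> ij; rewrite /g relationE big_seq big1 // => t /exponentsP[tps tN].
  have [->|ct] := eqVneq (c (i :: t)) 0; first by rewrite scale0r.
  have /j_min : `[< shifted i >] by apply/asboolP; exists t.
  by rewrite leqNgt ij.
have gP : pi (g j) \notin P 1%N.
  apply: (IH (fun i => P i.+1)) => // i ips.
  exact: (chain i.+1).
apply: contra gP => relP.
have relE : relation N (p :: ps) c =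
    p ^+ j * (g j + p * \sum_(i < N | (j < i)%N) p ^+ (i - j.+1) * g i).
  rewrite /= (bigD1 (Ordinal jN)) //= mulrDr -/(g j); congr (_ + _).
  rewrite mulrA -exprSr mulr_sumr (bigID (fun i : 'I_N => (j < i)%N)) /=.
  rewrite [X in _ + X]big1 ?addr0 => [|i]; last first.
    move=> /andP[ij ji]; rewrite -/(g i) g0 ?mulr0 // ltn_neqAle.
    by rewrite (ij : val i != j) leqNgt ji.
  apply: eq_big => [i|i /andP[_ ji]]; last by rewrite mulrA -exprD subnKC.
  by have [ji|] := ltnP j i; rewrite ?andbF // andbT -val_eqE /= gtn_eqF.
have pX i : pi p ^+ i \notin P 0%N.
  elim: i => [|i IHi]; first by rewrite expr0 idealr1.
  by rewrite exprS prime_idealrM negb_or pP0.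
move: relP; rewrite relE rmorphM rmorphXn prime_idealrM (negPf (pX j)) /= => /P01.
by rewrite rmorphD rpredDr // rmorphM mulrC idealMr.
Qed.

(** [F] collects the variables outside the smallest prime, modulo which every polynomial agrees with
    its restriction to [F]. The witnesses of the [r] strict inclusions can thus be taken in the
    variables of [F]; if r > #|F| they satisfy a nontrivial relation, which [relation_notin_prime]
    forbids. *)
Lemma prime_chain_face r : irreflexive e ->
  prime_chain A r -> exists2 F, F \in Ind e & (r <= #|F|)%N.
Proof.
move=> e_irr [p chain]; pose F := [set i | edge_var k e i \notin p ord0].
have FI : F \in Ind e.
  apply/IndP => i j; rewrite !inE => xi xj; apply/negP => eij.
  suff : edge_var k e i * edge_var k e j \in p ord0.
    by rewrite prime_idealrM (negPf xi) (negPf xj).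
  rewrite /edge_var -rmorphM /= (_ : pi _ = 0) ?idealr0 // -(rmorph0 pi).
  apply/eqP; rewrite eq_to_edge_ring subr0; apply/edge_idealP => // m /IndP mI.
  rewrite -mpolyXD mcoeffX; have [mE|//] := eqVneq.
  suff [mi mj] : i \in vars m /\ j \in vars m by have /negP[] := mI i j mi mj.
  by rewrite -mE varsD !vars1 !inE !eqxx orbT.
exists F => //; rewrite leqNgt; apply/negP => Fr.
have restrictP q : pi q - pi (restrict F q) \in p ord0.
  elim/mpolyind: q => [|c m q _ _ IH].
    by rewrite !rmorph0 subrr idealr0.
  rewrite !rmorphD opprD addrACA rpredD // -rmorphB -mul_mpolyC rmorphM /=.
  rewrite /restrict comp_mpolyC -/(restrict F) -mulrBr rmorphM idealMr //.
  rewrite restrictX; case: ifPn => [_|/subsetPn[i mi iF]]; first by rewrite subrr rmorph0 idealr0.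
  have im : (U_(i) <= m)%MM.
    apply/mnm_lepP => j; rewrite mnm1E; have [<-|//] := eqVneq i j.
    by rewrite inE -lt0n in mi.
  rewrite subr0 -(submK im) mpolyXD rmorphM idealMr //.
  by move: iF; rewrite inE negbK.
pose P i := p (inord i).
have /choice[q qP] : forall i, exists q : {mpoly k[n]}, (i < r)%N ->
    pi q \in P i.+1 /\ pi q \notin P i.
  move=> i; have [ir|] := ltnP i r; last by exists 0.
  have [|_ nsub] := chain (inord i) (inord i.+1); first by rewrite !inordK // ltnS ltnW.
  apply: contrapT => none; apply: nsub => a; elim/to_edge_ring_ind: a => q qP.
  by apply: contrapT => /negP qP'; apply: none; exists q.
have subP i j : (i < j <= r)%N -> {subset P i <= P j}.
  by move=> /andP[ij jr]; have [|//] := chain (inord i) (inord j);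
     rewrite !inordK // ltnS ltnW // (leq_trans ij).
have p0E : p ord0 = P 0%N by congr p; apply/val_inj; rewrite /= inordK.
have qE i j : (j <= r)%N -> (pi (restrict F (q i)) \in P j) = (pi (q i) \in P j).
  move=> jr; have qF : pi (q i) - pi (restrict F (q i)) \in P j.
    have := restrictP (q i); rewrite p0E.
    by case: j jr => [//|j] jr /(subP 0%N); apply.
  by rewrite -[in RHS](subrK (pi (restrict F (q i))) (pi (q i))) rpredDl.
pose qs := [seq restrict F (q i) | i <- iota 0 r].
have sqs : size qs = r by rewrite size_map size_iota.
have [_ /mapP[i _ ->] m||N [c [c_nt c0]]] := @algebraic_dependence k n F qs.
- by rewrite mcoeff_restrict; case: ifP => //; rewrite eqxx.
- by rewrite sqs.
have := @relation_notin_prime N qs P c _ c_nt.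
rewrite c0 rmorph0 idealr0 sqs => /(_ _)/negP; apply=> // i ir.
rewrite (nth_map 0%N) ?size_iota // nth_iota // add0n !qE ?(ltnW ir) //.
by have [qP1 qP0] := qP i ir; split=> //; apply: subP; rewrite ltnSn.
Qed.

End KrullUpperBound.

(** * Regular sequences for complexes of dimension at most one *)

Lemma mpoly_of_coeffs (k : fieldType) (n : nat) (c : 'X_{1..n} -> k) (r : seq 'X_{1..n}) :
  (forall m, c m != 0 -> m \in r) -> exists p : {mpoly k[n]}, forall m, p@_m = c m.
Proof.
move=> cr; exists (\sum_(u <- undup r) c u *: 'X_[u]) => m; rewrite raddf_sum /=.
rewrite (eq_bigr (fun u => c u * (u == m)%:R)) => [|u _]; last by rewrite mcoeffZ mcoeffX.
have [mr|mr] := boolP (m \in r); last first.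
  have -> : c m = 0 by apply/eqP; apply: contraNT mr => /cr.
  rewrite big_seq big1 // => u; rewrite mem_undup => ur.
  by have [um|] := eqVneq u m; rewrite ?mulr0 // -um ur in mr *.
rewrite (bigD1_seq m) ?mem_undup ?undup_uniq //= eqxx mulr1 big1 ?addr0 // => u.
by move=> /negPf->; rewrite mulr0.
Qed.

Section CohenMacaulay.
Variables (k : fieldType) (n : nat) (e : rel 'I_n).
Hypothesis e_irr : irreflexive e.

Local Notation A := (edge_ring k e).
Local Notation pi := (@to_edge_ring k n e).
Local Notation face m := (vars m \in Ind e).

Lemma max_size_facet F :
  F \in Ind e -> (forall H, H \in Ind e -> #|H| <= #|F|)%N -> F \in facets (Ind e).
Proof.
move=> FI F_max; rewrite inE; apply/maxsetP; split=> // H HI FH.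
by apply/esym/eqP; rewrite eqEcard FH F_max.
Qed.

(** A largest face bounds the length of prime chains and, being a facet, that of regular sequences,
    so one regular sequence of that length suffices. *)
Lemma cohen_macaulay_of_regular F (s : seq {mpoly k[n]}) :
  F \in Ind e -> (forall H, H \in Ind e -> #|H| <= #|F|)%N ->
  size s = #|F| -> {subset s <= @max_ideal k n} -> regular_seq (map pi s) ->
  cohen_macaulay k e.
Proof.
move=> FI F_max sF s_max s_reg; exists #|F|; split; split.
- exact: face_prime_chain FI.
- by move=> r /(prime_chain_face e_irr)[H /F_max HF rH]; exact: leq_trans HF.
- by exists s.
- move=> _ [t [<- t_max t_reg]]; apply: (facet_depth e_irr _ t_reg t_max).
  exact: max_size_facet.
Qed.

Lemma max_ideal_proper (s : seq {mpoly k[n]}) :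
  {subset s <= @max_ideal k n} -> 1 \notin ideal_gen (map pi s).
Proof.
have f0 : face (0%MM : 'X_{1..n}) by rewrite vars0; apply/IndP => i j; rewrite inE.
move=> s_max; apply/negP => /ideal_genP[c] /(congr1 (ecoef 0%MM))/eqP.
rewrite -(rmorph1 pi) ecoef_pi // mcoeff1 eqxx ecoef_sum // big1 ?oner_eq0 // => i _.
set a := (X in _ * X); have : a \in map pi s by rewrite mem_nth.
case/mapP=> f /s_max/(max_idealP e)/ideal_gen_map[b ->] ->.
rewrite mulr_sumr ecoef_sum // big1 // => j _; rewrite mulrA ecoefMX //.
by case: ifP => // /mnm_lepP/(_ j); rewrite mnm1E mnm0E eqxx.
Qed.

Definition linear_form : {mpoly k[n]} := \sum_i 'X_i.

(** Modulo the edge ideal this is the second elementary symmetric polynomial, as products over pairs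
    that are not faces vanish; the linear form is the first. *)
Definition edge_form : {mpoly k[n]} :=
  \sum_(F in Ind e | #|F| == 2) 'X_[monom (enum F)].

Lemma linear_form_max : linear_form \in @max_ideal k n.
Proof.
by apply: ideal_gen_sum => i _; apply/mem_ideal_gen/map_f; rewrite mem_enum.
Qed.

Lemma edge_form_max : edge_form \in @max_ideal k n.
Proof.
apply: ideal_gen_sum => F /andP[_ /eqP F2].
case E: (enum F) => [|i s]; first by move: F2; rewrite cardE E.
rewrite /monom big_cons mpolyXD mulrC; apply/ideal_genM/mem_ideal_gen/map_f.
by rewrite mem_enum.
Qed.

Lemma lem1_vars (m : 'X_{1..n}) (i : 'I_n) : (U_(i) <= m)%MM = (i \in vars m).
Proof.
rewrite inE -lt0n; apply/mnm_lepP/idP => [/(_ i)|mi j]; rewrite mnm1E ?eqxx //.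
by have [<-|] := eqVneq i j.
Qed.

Lemma ecoef_linear_form m (a : A) : face m ->
  ecoef m (a * pi linear_form) = \sum_(i in vars m) ecoef (m - U_(i)) a.
Proof.
move=> fm; rewrite rmorph_sum mulr_sumr ecoef_sum // [RHS]big_mkcond.
by apply: eq_bigr => i _; rewrite ecoefMX // lem1_vars.
Qed.

Lemma lem_monom_enum (m : 'X_{1..n}) (F : {set 'I_n}) : (monom (enum F) <= m)%MM = (F \subset vars m).
Proof.
apply/mnm_lepP/subsetP => [Fm i iF|Fm i].
  by have := Fm i; rewrite monomE count_uniq_mem ?enum_uniq // mem_enum iF inE -lt0n.
rewrite monomE count_uniq_mem ?enum_uniq // mem_enum.
by case: (boolP (i \in F)) => // /Fm; rewrite inE -lt0n.
Qed.

Lemma ecoef_edge_form m (a : A) : face m -> (forall F, F \in Ind e -> #|F| <= 2)%N ->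
  ecoef m (a * pi edge_form)
  = if #|vars m| == 2 then ecoef (m - monom (enum (vars m))) a else 0.
Proof.
move=> fm dim1; rewrite rmorph_sum mulr_sumr ecoef_sum //.
rewrite (eq_bigr (fun F : {set _} => if F \subset vars m then ecoef (m - monom (enum F)) a else 0)).
  case: ifPn => [m2|nm2]; last first.
    rewrite big1 // => F /andP[FI /eqP F2]; case: ifP => // /subset_leq_card.
    by rewrite F2 => m2; case/negP: nm2; rewrite eqn_leq m2 dim1.
  rewrite (bigD1 (vars m)) ?fm //= subxx big1 ?addr0 // => F.
  case/andP=> /andP[_ /eqP F2] Fm; case: ifP => // sFm; case/eqP: Fm.
  by apply/eqP; rewrite eqEcard sFm F2 (eqP m2).
by move=> F _; rewrite ecoefMX // lem_monom_enum.
Qed.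

(** The coefficient at a face monomial survives restriction to a nonempty face containing its
    support. There the linear form stays nonzero, in a polynomial ring, which is a domain. *)
Lemma linear_form_regular (a : A) : (0 < n)%N -> pi linear_form * a = 0 -> a = 0.
Proof.
move=> n0; elim/to_edge_ring_ind: a => p /eqP.
rewrite -rmorphM /= -[0 in X in X -> _](rmorph0 pi) eq_to_edge_ring subr0 => /edge_idealP lp.
apply: ecoef_inj => // m fm; rewrite ecoef0 // ecoef_pi //.
have [F [FI mF [i iF]]] : exists F, [/\ F \in Ind e, vars m \subset F & exists i, i \in F].
  have [m0|/set0Pn mi] := eqVneq (vars m) set0; last by exists (vars m); split.
  exists [set Ordinal n0]; split; last by exists (Ordinal n0); rewrite inE.
    by apply/IndP => i j /set1P-> /set1P->; rewrite e_irr.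
  by rewrite m0 sub0set.
have : restrict F (linear_form * p) == 0.
  by apply/restrict_eq0 => u uF; apply: lp => //; exact: IndS FI.
rewrite rmorphM mulf_eq0 => /orP[/restrict_eq0/(_ U_(i)%MM)|/restrict_eq0->//].
rewrite vars1 sub1set => /(_ iF)/eqP; rewrite raddf_sum (bigD1 i) //= mcoeffX eqxx.
rewrite big1 ?addr0 ?oner_eq0 // => j /negPf ji; rewrite mcoeffX.
by have [/mnmP/(_ j)|//] := eqVneq; rewrite !mnm1E eqxx eq_sym ji.
Qed.

End CohenMacaulay.

Definition edge_connected (T : finType) (D : {set {set T}}) : Prop :=
  forall W : {set T}, W != set0 ->
    (forall i j, i \in W -> [set i; j] \in D -> j \in W) -> W = setT.

Section LowDimension.
Variables (k : fieldType) (n : nat) (e : rel 'I_n).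
Hypotheses (e_irr : irreflexive e) (n_gt0 : (0 < n)%N).

Local Notation A := (edge_ring k e).
Local Notation pi := (@to_edge_ring k n e).
Local Notation face m := (vars m \in Ind e).

Lemma cohen_macaulay_dim0 :
  (forall F, F \in Ind e -> #|F| <= 1)%N -> cohen_macaulay k e.
Proof.
move=> dim0; pose F := [set Ordinal n_gt0].
have F1 : #|F| = 1%N by exact: cards1.
have l_max : {subset [:: linear_form k n] <= @max_ideal k n}.
  by move=> _ /[!inE] /eqP->; exact: linear_form_max.
apply: (@cohen_macaulay_of_regular k n e e_irr F [:: linear_form k n]) => //.
- by apply/IndP => i j /set1P-> /set1P->; rewrite e_irr.
- by move=> H /dim0; rewrite F1.
split=> [|[|//] _ a /=]; first exact: max_ideal_proper.
by rewrite ideal_gen_nil => /eqP/linear_form_regular->; rewrite ?ideal_gen0.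
Qed.

Section Dim1.
Hypothesis dim1 : (forall F, F \in Ind e -> #|F| <= 2)%N.
Hypothesis conn : edge_connected (Ind e).
Hypothesis no_isolated : forall i, exists2 j, i != j & [set i; j] \in Ind e.

Let nb i j := (i != j) && ([set i; j] \in Ind e).

Let nb_sym i j : nb i j = nb j i.
Proof. by rewrite /nb eq_sym setUC. Qed.

Section Division.
Variables a b : A.
Hypothesis ab : pi (edge_form k e) * a = b * pi (linear_form k n).
Implicit Types m : 'X_{1..n}.

(** At the monomial m x_i, supported on one vertex, the edge form contributes nothing and the linear
    form only the coefficient of [b] at [m]. *)
Let ecoef_vertex m i : vars m \subset [set i] -> ecoef m b = 0.
Proof.
move=> mi; have vm : vars (m + U_(i))%MM = [set i].
  by rewrite varsD vars1; apply/setUidPr.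
have fm : face (m + U_(i))%MM.
  by rewrite vm; apply/IndP => u v /set1P-> /set1P->; rewrite e_irr.
have := congr1 (ecoef (m + U_(i))%MM) ab; rewrite mulrC ecoef_edge_form //.
by rewrite ecoef_linear_form // vm cards1 big_set1 addmK.
Qed.

Let ecoef_edge m i j : nb i j -> vars m \subset [set i; j] ->
  ecoef m a = ecoef (m + U_(j))%MM b + ecoef (m + U_(i))%MM b.
Proof.
case/andP=> ij fij mij; pose M := (m + (U_(i) + U_(j)))%MM.
have vM : vars M = [set i; j] by rewrite /M !varsD !vars1; apply/setUidPr.
have fM : face M by rewrite vM.
have ME : monom (enum [set i; j]) = (U_(i) + U_(j))%MM.
  apply/mnmP => t; rewrite monomE count_uniq_mem ?enum_uniq // mem_enum !inE.
  rewrite mnmDE !mnm1E ![_ == t]eq_sym.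
  by have [->|] := eqVneq t i; [rewrite (negPf ij) | case: eqVneq].
have := congr1 (ecoef M) ab; rewrite mulrC ecoef_edge_form //.
rewrite ecoef_linear_form // vM cards2 ij eqxx ME addmK => ->.
have -> : (m + U_(j) = M - U_(i))%MM by apply/mnmP => t; rewrite mnmBE !mnmDE; lia.
have -> : (m + U_(i) = M - U_(j))%MM by apply/mnmP => t; rewrite mnmBE !mnmDE; lia.
by rewrite big_setU1 ?inE // big_set1.
Qed.

Let ecoef_slope m i j : nb i j -> vars m \subset [set i] ->
  ecoef (m + U_(i) + U_(j))%MM b = ecoef (m + U_(i))%MM a.
Proof.
move=> ij mi; rewrite (ecoef_edge ij) ?[ecoef (_ + U_(i)) b](@ecoef_vertex _ i) ?addr0 //.
  by rewrite !varsD !vars1 !subUset mi subxx.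
by rewrite varsD vars1 subUset sub1set !inE eqxx (subset_trans mi) // sub1set !inE eqxx.
Qed.

(** The ends of an edge have equal coefficients, both being the coefficient of [b] at the product of
    their variables. Connectedness spreads this to all vertices. *)
Let ecoef_const i j : ecoef U_(i)%MM a = ecoef U_(j)%MM a.
Proof.
pose W := [set t | ecoef U_(t)%MM a == ecoef U_(i)%MM a].
have /setP/(_ j) : W = setT; last by rewrite !inE => /eqP->.
apply: conn => [|u v]; first by apply/set0Pn; exists i; rewrite inE.
rewrite inE => /eqP ui fuv; rewrite inE -ui; have [<-//|uv] := eqVneq u v.
have nuv : nb u v by rewrite /nb uv fuv.
have vu : nb v u by rewrite nb_sym.
have := ecoef_slope nuv (_ : vars 0 \subset _); have := ecoef_slope vu (_ : vars 0 \subset _).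
by rewrite vars0 !sub0set !add0m addmC => <- // -> .
Qed.

(* The coefficients of the quotient of a by the linear form, which do not depend
   on the edge used to compute them. *)
Let ecoef_quotient m i j u v :
  nb i j -> nb u v -> vars m \subset [set i; j] -> vars m \subset [set u; v] ->
  ecoef (m + U_(i) + U_(j))%MM b = ecoef (m + U_(u) + U_(v))%MM b.
Proof.
have comm s t : (m + U_(s) + U_(t) = m + U_(t) + U_(s))%MM by rewrite -!addmA [(U_(s) + _)%MM]addmC.
wlog iu : i j u v / i = u => [wlg|].
  move=> ij uv mij muv.
  (* For the constant monomial both sides are linear coefficients of [a]. Otherwise both edges
     contain a vertex [t] of the support, which by symmetry can be taken as their first end. *)
  have [m0|/set0Pn[t tm]] := eqVneq (vars m) set0.
    rewrite !ecoef_slope ?m0 ?sub0set //.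
    have -> : m = 0%MM.
      apply/mnmP => t; rewrite mnm0E; apply/eqP.
      by have /setP/(_ t) := m0; rewrite !inE => /negbFE.
    by rewrite !add0m; exact: ecoef_const.
  have := subsetP mij t tm; have := subsetP muv t tm.
  by rewrite !inE => /orP[] /eqP tu /orP[] /eqP ti;
    [|rewrite (comm i j)|rewrite (comm u v)|rewrite (comm i j) (comm u v)];
    apply: wlg; rewrite -?ti -?tu //; move: ij uv mij muv;
    rewrite -?ti -?tu ?[nb _ t]nb_sym ?[[set _; t]]setUC.
rewrite -{}iu => ij iv mij miv; have [<-//|jv] := eqVneq j v.
have mi : vars m \subset [set i].
  apply/subsetP => t tm; have := subsetP mij t tm; have := subsetP miv t tm.
  rewrite !inE; case: eqVneq => //= _ /eqP-> /eqP vj; by rewrite vj eqxx in jv.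
by rewrite !ecoef_slope.
Qed.

(** This is the regularity of the edge form modulo the linear form. The coefficient of the quotient
    at [m] is that of [b] at m x_i x_j, for an edge {i, j} containing the support of [m]. *)
Lemma linear_form_dvd : exists c, a = c * pi (linear_form k n).
Proof.
have /choice[E EP] : forall m, exists ij, face m ->
    nb ij.1 ij.2 /\ vars m \subset [set ij.1; ij.2].
  move=> m; have [fm|] := boolP (face m); last by exists (Ordinal n_gt0, Ordinal n_gt0).
  have [m0|/set0Pn[i im]] := eqVneq (vars m) set0.
    have [j ij fij] := no_isolated (Ordinal n_gt0).
    by exists (Ordinal n_gt0, j); rewrite /= /nb ij fij m0 sub0set.
  have [mi|/subsetPn[j jm]] := boolP (vars m \subset [set i]).
    have [j ij fij] := no_isolated i; exists (i, j); rewrite /= /nb ij fij.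
    by split=> //; apply: subset_trans mi _; rewrite sub1set !inE eqxx.
  rewrite inE => ji; have sij : [set i; j] \subset vars m by rewrite subUset !sub1set im.
  have mE : [set i; j] = vars m.
    by apply/eqP; rewrite eqEcard sij cards2 eq_sym ji dim1.
  by exists (i, j); rewrite /= /nb mE fm eq_sym ji subxx.
pose g m := if face m then ecoef (m + U_((E m).1) + U_((E m).2))%MM b else 0.
have [c cE] : exists c : {mpoly k[n]}, forall m, c@_m = g m.
  apply: (mpoly_of_coeffs (r := [seq (u - U_(ij.1) - U_(ij.2))%MM |
     u <- msupp (repr b), ij <- enum {: 'I_n * 'I_n}])).
  move=> m; rewrite /g; case: ifP => [fm|_]; last by rewrite eqxx.
  rewrite /ecoef -mcoeff_msupp => bm; apply/allpairsP; 
    exists ((m + U_((E m).1) + U_((E m).2))%MM, E m); split=> //.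
  - by rewrite mem_enum.
  by apply/mnmP => t; rewrite !mnmBE !mnmDE /=; lia.
exists (pi c); apply: ecoef_inj => // m fm; rewrite ecoef_linear_form //.
have [ij mij] := EP m fm; set i := (E m).1 in ij mij; set j := (E m).2 in ij mij.
rewrite (ecoef_edge ij mij).
(* The two summands of [ecoef_edge] are the contributions of x_i and x_j to the quotient times the
   linear form. If x_s does not divide [m], then m x_t is a power of x_t, where [b] has coefficient
   0. *)
have term s t : nb s t -> vars m \subset [set s; t] ->
    ecoef (m + U_(t))%MM b = if s \in vars m then ecoef (m - U_(s))%MM (pi c) else 0.
  move=> st mst; case: ifPn => [sm|sm]; last first.
    apply: (@ecoef_vertex _ t); rewrite varsD vars1 subUset subxx andbT.
    apply/subsetP => u um; have := subsetP mst u um; rewrite !inE.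
    by case: eqVneq => // us; rewrite -us um in sm.
  have ms : (m - U_(s) + U_(s) = m)%MM by rewrite submK // lem1_vars.
  have vms : vars (m - U_(s)) \subset vars m by rewrite -{2}ms varsD subsetUl.
  have fms : face (m - U_(s))%MM by apply: IndS fm.
  rewrite ecoef_pi // cE /g fms; have [uv muv] := EP _ fms.
  by rewrite -(@ecoef_quotient _ s t) ?ms // (subset_trans vms).
rewrite (term _ _ ij mij) (term j i) ?[nb j i]nb_sym //; last by rewrite setUC.
have /andP[ij' _] := ij.
rewrite big_mkcond (bigD1 i) //= (bigD1 j) 1?eq_sym //= big1 ?addr0 // => t /andP[ti tj].
case: ifP => // /(subsetP mij); by rewrite !inE (negPf ti) (negPf tj).
Qed.

End Division.

Lemma cohen_macaulay_dim1 : cohen_macaulay k e.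
Proof.
have [j ij fij] := no_isolated (Ordinal n_gt0).
pose s := [:: linear_form k n; edge_form k e].
have s_max : {subset s <= @max_ideal k n}.
  move=> _ /[!inE] /orP[] /eqP->; [exact: linear_form_max | exact: edge_form_max].
apply: (@cohen_macaulay_of_regular k n e e_irr _ s fij) => //.
- by move=> H /dim1; rewrite cards2 ij.
- by rewrite cards2 ij.
split=> [|[|[|//]] _ a /=]; first exact: max_ideal_proper.
  by rewrite ideal_gen_nil => /eqP/linear_form_regular->; rewrite ?ideal_gen0.
rewrite -[[:: pi _]]/(rcons [::] (pi (linear_form k n))) => /ideal_gen_rcons[b].
rewrite ideal_gen_nil subr_eq0 => /eqP/linear_form_dvd[c ->].
by apply/ideal_gen_rcons; exists c; rewrite subrr ideal_gen0.
Qed.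

End Dim1.
End LowDimension.

Local Close Scope ring_scope.

(** * Vertex decomposable and shellable complexes *)

Section Complexes.
Variable T : finType.
Implicit Types (D : {set {set T}}) (F G H W : {set T}) (x y : T).

Lemma facetP D F :
  reflect (F \in D /\ forall H, H \in D -> F \subset H -> H = F) (F \in facets D).
Proof. by rewrite inE; exact: maxsetP. Qed.

Lemma facet_face D F : F \in facets D -> F \in D.
Proof. by case/facetP. Qed.

Lemma facet_exists D F : F \in D -> exists2 H, H \in facets D & F \subset H.
Proof.
by move=> /(maxset_exists (P := mem D))[H H_max FH]; exists H; rewrite ?inE.
Qed.

Lemma facet_card_max D F :
  pure D -> F \in D -> (exists2 H, H \in facets D & #|H| <= #|F|) -> F \in facets D.
Proof.
move=> D_pure /facet_exists[K KD FK] [H HD HF].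
suff -> : F = K by [].
by apply/eqP; rewrite eqEcard FK (D_pure K H).
Qed.

Lemma in_link D x H :
  (H \in link D [set x]) = [&& H \in D, x \notin H & x |: H \in D].
Proof. by rewrite !inE disjoints1. Qed.

Lemma in_del D x F : (F \in del D x) = (F \in D) && (x \notin F).
Proof. by rewrite inE. Qed.

Lemma facets_link D x H : simplicial_complex D ->
  (H \in facets (link D [set x])) = (x \notin H) && (x |: H \in facets D).
Proof.
move=> [_ DS]; apply/facetP/andP => [[]|[xH /facetP[xHD xH_max]]].
  rewrite in_link => /and3P[HD xH xHD] H_max; split=> //; apply/facetP; split=> // K KD.
  rewrite subUset sub1set => /andP[xK HK]; rewrite -(setD1K xK); congr (_ |: _).
  apply: H_max; last by rewrite subsetD1 HK.
  by rewrite in_link setD11 setD1K // KD (DS _ _ KD) ?subsetDl.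
split=> [|K]; first by rewrite in_link xH xHD (DS _ _ xHD) ?subsetUr.
rewrite in_link => /and3P[_ xK xKD] HK.
by rewrite -(setU1K xK) -(setU1K xH) (xH_max _ xKD) ?setUS.
Qed.

(** A facet of a deletion may lie in a larger face through [x]. Purity excludes this once some facet
    of [D] avoids [x], as that facet fixes the common size. *)
Lemma facets_del D x F : pure (del D x) -> pure D ->
  (exists2 G, G \in facets D & x \notin G) ->
  (F \in facets (del D x)) = (F \in facets D) && (x \notin F).
Proof.
move=> E_pure D_pure [G GD xG].
have del_facet H : H \in facets D -> x \notin H -> H \in facets (del D x).
  move=> /facetP[HD H_max] xH; apply/facetP; rewrite in_del HD xH; split=> // K.
  by rewrite in_del => /andP[KD _]; exact: H_max.
apply/idP/andP => [FE|[FD xF]]; last exact: del_facet.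
have := facet_face FE; rewrite in_del => /andP[FD xF]; split=> //.
apply: facet_card_max => //; exists G => //.
by rewrite (E_pure F G FE (del_facet _ GD xG)).
Qed.

(** The facets avoiding [x] come first, in the order of the deletion, then the facets through [x],
    in the order of the link. *)
Lemma vertex_decomposable_shellable D :
  simplicial_complex D -> vertex_decomposable D -> shellable D.
Proof.
move=> + D_vd; elim: D_vd => {}D.
  move=> D_pure facetsE _; split=> //; exists [:: vertices D].
    by rewrite facetsE enum_set1.
  by move=> i j /andP[ji]; rewrite ltnS leqn0 => /eqP i0; rewrite i0 in ji.
move=> x D_pure xV _ IHL _ IHE DC.
have DS := DC.2.
have xD : [set x] \in D.
  by case/bigcupP: xV => F FD xF; apply: DS FD _; rewrite sub1set.
have [_ [Ls LsE L_shell]] := IHL (link_complex DC xD).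
have [E_pure [Es EsE E_shell]] := IHE (del_complex x DC).
have memL H : (H \in Ls) = (x \notin H) && (x |: H \in facets D).
  by rewrite (perm_mem LsE) mem_enum facets_link.
have memE F : (F \in Es) = (F \in facets (del D x)).
  by rewrite (perm_mem EsE) mem_enum.
have Es_uniq : uniq Es by rewrite (perm_uniq EsE) enum_uniq.
have Ls_uniq : uniq Ls by rewrite (perm_uniq LsE) enum_uniq.
(* If every facet contains x, then D is a cone over the link. *)
pose avoid := [exists F in facets D, x \notin F].
pose Fs1 := if avoid then Es else [::]; pose Fs2 := [seq x |: H | H <- Ls].
split=> //; exists (Fs1 ++ Fs2).
  apply: uniq_perm; rewrite ?enum_uniq //.
    rewrite cat_uniq; apply/and3P; split.
    - by rewrite /Fs1; case: ifP.
    - apply/hasPn => _ /mapP[H HL ->]; rewrite /Fs1; case: ifP => // _.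
      by rewrite memE; apply/negP => /facet_face; rewrite in_del setU11 andbF.
    rewrite map_inj_in_uniq // => H K; rewrite !memL => /andP[xH _] /andP[xK _] HK.
    by rewrite -(setU1K xH) HK setU1K.
  move=> F; rewrite mem_cat mem_enum; apply/orP/idP => [[]|FD].
  - rewrite /Fs1; case: ifP => // /exists_inP[G GD xG].
    by rewrite memE facets_del //; [case/andP | exists G].
  - by case/mapP=> H; rewrite memL => /andP[_ HD] ->.
  have [xF|xF] := boolP (x \in F).
    right; apply/mapP; exists (F :\ x); rewrite ?setD1K //.
    by rewrite memL setD11 setD1K.
  left; have av : avoid by apply/exists_inP; exists F.
  by rewrite /Fs1 av memE facets_del ?FD //; exists F.
have nth2 i : i < size Ls -> nth set0 Fs2 i = x |: nth set0 Ls i.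
  by move=> iL; rewrite (nth_map set0).
have xLs i : i < size Ls -> x \notin nth set0 Ls i.
  by move=> /(mem_nth set0); rewrite memL => /andP[].
move=> i j; rewrite size_cat !nth_cat size_map => /andP[ji iF].
have [i1|i1] := ltnP i (size Fs1).
  rewrite (ltn_trans ji i1).
  have av : avoid by move: i1; rewrite /Fs1; case: ifP.
  have Fs1E : Fs1 = Es by rewrite /Fs1 av.
  rewrite Fs1E in i1 *; have [|y [l [yF li yl]]] := E_shell i j; first by rewrite ji.
  by exists y, l; rewrite nth_cat (ltn_trans li i1).
have iL : i - size Fs1 < size Ls by lia.
have [j1|j1] := ltnP j (size Fs1).
  have av : avoid by move: j1; rewrite /Fs1; case: ifP.
  have jE : nth set0 Fs1 j \in Es by rewrite -[Es]/(if true then Es else [::]) -av mem_nth.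
  have xj : x \notin nth set0 Fs1 j.
    by move: jE; rewrite memE => /facet_face; rewrite in_del => /andP[].
  (* The facet of the link avoids [x], so it lies in a facet [K] of the deletion, which comes
     earlier; the new facet minus [K] is just [x]. *)
  have [K KE HK] : exists2 K, K \in facets (del D x) & nth set0 Ls (i - size Fs1) \subset K.
    apply: facet_exists; rewrite in_del xLs // andbT.
    have := mem_nth set0 iL; rewrite memL => /andP[_ /facet_face/DS]; apply.
    exact: subsetUr.
  have xK : x \notin K by have := facet_face KE; rewrite in_del => /andP[].
  have KF : K \in Fs1 by rewrite /Fs1 av memE.
  exists x, (index K Fs1); rewrite nth_cat index_mem KF nth_index // nth2 //; split.
  - by rewrite !inE eqxx xj.
  - by apply: leq_trans i1; rewrite index_mem.
  apply/setP => y; rewrite !inE; have [->|_] := eqVneq; first by rewrite xK.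
  apply/esym/negbTE; rewrite negb_and negbK; have [//|yK] := boolP (y \in K).
  by apply: contra yK; exact: (subsetP HK).
have diff u v : u < size Ls -> (x |: nth set0 Ls u) :\: (x |: nth set0 Ls v)
    = nth set0 Ls u :\: nth set0 Ls v.
  move=> /xLs xu; apply/setP => y; rewrite !inE; have [->|//] := eqVneq y x.
  by rewrite (negPf xu) andbF.
have [|y [l [yF li yl]]] := L_shell (i - size Fs1) (j - size Fs1).
  by rewrite iL andbT; lia.
exists y, (size Fs1 + l); rewrite nth_cat [_ + l < size _]ltnNge leq_addr /= addKn.
have lL : l < size Ls by exact: ltn_trans li iL.
have jL : j - size Fs1 < size Ls by apply: leq_ltn_trans iL; rewrite leq_sub2r // ltnW.
by rewrite !nth2 // !diff //; split=> //; rewrite -ltn_subRL.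
Qed.

End Complexes.

(** * Vertex decomposability in dimension at most one *)

Section VertexDecomposable.
Variable T : finType.
Implicit Types (D : {set {set T}}) (F G H W : {set T}) (x y : T).

Definition points W : {set {set T}} := [set F in powerset W | #|F| <= 1].

Lemma points_pure W : pure (points W).
Proof.
suff cardF F : F \in facets (points W) -> #|F| = (W != set0).
  by move=> F H /cardF-> /cardF->.
case/facetP; rewrite !inE => /andP[FW F1] F_max.
have [W0|/set0Pn[w wW]] := eqVneq W set0.
  by apply/eqP; rewrite cards_eq0 -subset0 -W0.
apply/eqP; rewrite eqn_leq F1 card_gt0; apply/eqP => F0.
have := F_max [set w]; rewrite !inE sub1set wW cards1 F0 sub0set.
by move=> /(_ isT isT)/setP/(_ w); rewrite !inE eqxx.
Qed.

Lemma simplex_vertex_decomposable D F :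
  facets D = [set F] -> vertex_decomposable D.
Proof.
move=> DF; have D_pure : pure D by move=> G H; rewrite DF !inE => /eqP-> /eqP->.
suff VF : vertices D = F by apply: VDSimplex; rewrite // VF.
apply/eqP; rewrite eqEsubset; apply/andP; split.
  apply/bigcupsP => G /facet_exists[H]; rewrite DF inE => /eqP->; exact.
by apply: bigcup_sup; apply: facet_face; rewrite DF inE.
Qed.

Lemma points_vertex_decomposable W : vertex_decomposable (points W).
Proof.
have [m] := ubnP #|W|; elim: m W => // m IH W Wm.
have [W1|W2] := leqP #|W| 1.
  apply: (@simplex_vertex_decomposable _ W); apply/setP => F; rewrite [RHS]inE.
  apply/facetP/eqP => [[]|->]; rewrite !inE.
    by move=> /andP[FW _] F_max; apply/esym/F_max; rewrite // !inE subxx.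
  rewrite subxx W1; split=> // H; rewrite !inE => /andP[HW _] WH.
  by apply/eqP; rewrite eqEsubset HW.
have [x xW] : exists x, x \in W by apply/card_gt0P; lia.
apply: (@VDVertex _ _ x); first exact: points_pure.
- by apply/bigcupP; exists [set x]; rewrite !inE ?sub1set ?xW ?cards1.
- suff -> : link (points W) [set x] = points set0 by apply: IH; rewrite cards0; lia.
  apply/setP => F; rewrite in_link !inE subset0; apply/and3P/andP => [[]|[/eqP-> _]].
    move=> /andP[FW F1] xF /andP[_]; rewrite cardsU1 xF add1n ltnS leqn0 cards_eq0.
    by move=> /eqP->; rewrite cards0.
  by rewrite sub0set cards0 inE setU0 sub1set xW cards1.
- suff -> : del (points W) x = points (W :\ x).
    by apply: IH; have := cardsD1 x W; rewrite xW; lia.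
  by apply/setP => F; rewrite in_del !inE subsetD1 andbAC.
Qed.

Variable e : rel T.
Hypothesis dim1 : forall F, F \in Ind e -> #|F| <= 2.

Definition Ind_on W : {set {set T}} := [set F in Ind e | F \subset W].

Lemma in_Ind_on W F : (F \in Ind_on W) = (F \in Ind e) && (F \subset W).
Proof. by rewrite inE. Qed.

(** Read backwards, this is a shedding order: deleting the last vertex gives the previous induced
    complex, pure because every vertex keeps a neighbor, and the link of that vertex consists of
    points. *)
Inductive grown : {set T} -> Prop :=
| GrownEdge x y : x != y -> [set x; y] \in Ind e -> grown [set x; y]
| GrownVertex W x y : grown W -> x \in W -> y \notin W -> [set x; y] \in Ind e ->
    grown (y |: W).

Lemma grown_neighbor W x : grown W -> x \in W ->
  exists y, [/\ y \in W, x != y & [set x; y] \in Ind e].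
Proof.
move=> W_grown; elim: W_grown x => {W} [u v uv fuv x|W u v _ IH uW vW fuv x].
  case/set2P=> ->; first by exists v; rewrite set22.
  by exists u; rewrite set21 eq_sym setUC.
case/setU1P=> [->|/IH[y [yW xy fxy]]]; last by exists y; rewrite inE yW orbT.
exists u; rewrite inE uW orbT setUC; split=> //.
by apply: contraNneq vW => ->.
Qed.

Lemma Ind_on_pure W : grown W -> pure (Ind_on W).
Proof.
move=> W_grown; suff card2 F : F \in facets (Ind_on W) -> #|F| = 2.
  by move=> F H /card2-> /card2->.
case/facetP; rewrite inE => /andP[FI FW] F_max; apply/eqP.
rewrite eqn_leq dim1 // ltnNge; apply/negP => F1.
have [x [xW Fx]] : exists x, x \in W /\ F \subset [set x].
  have [F0|/set0Pn[x xF]] := eqVneq F set0.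
    have [x xW] : exists x, x \in W.
      by case: W_grown => [x y _ _|W' _ y _ _ _ _]; [exists x|exists y];
         rewrite !inE eqxx.
    by exists x; rewrite F0 sub0set.
  exists x; split; first exact: (subsetP FW).
  have : [set x] \subset F by rewrite sub1set.
  by move=> sxF; rewrite (_ : F = [set x]) //; apply/esym/eqP; rewrite eqEcard sxF cards1.
have [y [yW xy fxy]] := grown_neighbor W_grown xW.
have : [set x; y] = F.
  apply: F_max; first by rewrite inE fxy subUset !sub1set xW.
  by apply: subset_trans Fx _; rewrite sub1set !inE eqxx.
by move=> FE; move: F1; rewrite -FE cards2 xy.
Qed.

Lemma grown_vertex_decomposable W : grown W -> vertex_decomposable (Ind_on W).
Proof.
move=> W_grown; elim: (W_grown) => {W W_grown} [x y xy fxy|W x y W_grown VW xW yW fxy].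
  apply: (@simplex_vertex_decomposable _ [set x; y]); apply/setP => F.
  rewrite [RHS]inE; apply/facetP/eqP => [[]|->]; rewrite inE.
    by move=> /andP[_ FW] F_max; apply/esym/F_max; rewrite // inE fxy subxx.
  rewrite fxy subxx; split=> // H; rewrite inE => /andP[_ HW] WH.
  by apply/eqP; rewrite eqEsubset HW.
have yW_grown : grown (y |: W) by exact: GrownVertex fxy.
apply: (@VDVertex _ _ y); first exact: Ind_on_pure.
- apply/bigcupP; exists [set x; y]; last by rewrite !inE eqxx orbT.
  by rewrite inE fxy subUset !sub1set !inE xW eqxx orbT.
- suff -> : link (Ind_on (y |: W)) [set y] = points [set z in W | [set y; z] \in Ind e].
    exact: points_vertex_decomposable.
  apply/setP => F; rewrite in_link !in_Ind_on.
  rewrite [RHS]inE powersetE; apply/and3P/andP => [[]|[/subsetP FW F1]].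
    move=> /andP[FI FW] yF /andP[yFI yFW]; split; last first.
      by have := dim1 yFI; rewrite cardsU1 yF.
    apply/subsetP => z zF; rewrite inE; apply/andP; split.
      have := subsetP FW z zF; rewrite !inE => /orP[/eqP zy|//].
      by rewrite -zy zF in yF.
    apply: IndS yFI; apply/subsetP => u /set2P[]->; rewrite !inE ?eqxx ?zF ?orbT //.
  have yF : y \notin F by apply/negP => /FW; rewrite inE (negPf yW).
  have FW' : F \subset y |: W.
    by apply/subsetP => z /FW; rewrite !inE => /andP[->]; rewrite orbT.
  have yFI : y |: F \in Ind e.
    have [F0|/set0Pn[z zF]] := eqVneq F set0.
      rewrite F0 setU0; apply: IndS fxy; by rewrite sub1set !inE eqxx orbT.
    have FE : F = [set z].
      by apply/esym/eqP; rewrite eqEcard sub1set zF cards1.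
    by have := FW z zF; rewrite FE inE => /andP[].
  by rewrite yFI (IndS _ yFI) ?subsetUr // subUset sub1set setU11.
- suff -> : del (Ind_on (y |: W)) y = Ind_on W by [].
  apply/setP => F; rewrite in_del !in_Ind_on -andbA; congr (_ && _).
  apply/andP/idP => [[FW yF]|FW].
    apply/subsetP => z zF; have := subsetP FW z zF; rewrite !inE.
    by case/orP=> [/eqP zy|//]; rewrite -zy zF in yF.
  by rewrite (subset_trans FW) ?subsetUr //; split=> //; apply: contra yW; exact: (subsetP FW).
Qed.

Lemma vertex_decomposable_dim1 x y :
  edge_connected (Ind e) -> x != y -> [set x; y] \in Ind e ->
  vertex_decomposable (Ind e).
Proof.
move=> conn xy fxy.
suff T_grown : grown [set: T].
  have -> : Ind e = Ind_on [set: T].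
    by apply/setP => F; rewrite [RHS]inE subsetT andbT.
  exact: grown_vertex_decomposable.
suff grow m W : #|~: W| < m -> grown W -> grown [set: T].
  exact: (grow #|~: [set x; y]|.+1 [set x; y] (leqnn _) (GrownEdge xy fxy)).
elim: m W => // m IH W Wm W_grown.
have [<-//|WT] := eqVneq W setT.
have [u [v [uW vW fuv]]] : exists u v, [/\ u \in W, v \notin W & [set u; v] \in Ind e].
  apply: contrapT => none; case/eqP: WT; apply: conn.
    by case: W_grown => [a b _ _|W' _ b _ _ _ _]; apply/set0Pn; [exists a|exists b];
       rewrite !inE eqxx.
  move=> u v uW fuv; apply: contrapT => /negP vW; apply: none.
  by exists u, v.
apply: (IH (v |: W)); last exact: GrownVertex fuv.
have := cardsD1 v (~: W); rewrite inE vW add1n => cW.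
have -> : ~: (v |: W) = ~: W :\ v by apply/setP => z; rewrite !inE negb_or.
by rewrite -ltnS -cW.
Qed.

End VertexDecomposable.

(** * The first cohomology of a shellable complex *)

Section ShellableCohomology.
Local Open Scope ring_scope.
Variables (T : finType) (D : {set {set T}}) (k : zmodType) (psi : T -> T -> k).
Hypotheses
  (dim2 : forall F, F \in facets D -> (2 < #|F|)%N)
  (psi_anti : forall x y, psi y x = - psi x y)
  (psi_cocycle : forall x y z F, F \in D -> x \in F -> y \in F -> z \in F ->
     psi x z = psi x y + psi y z).

Let coboundary_on (beta : T -> k) (F : {set T}) :=
  {in F &, forall x y, psi x y = beta y - beta x}.

Let coboundary_cone F y a beta : F \in D -> a \in F -> y \in F ->
  psi a y = beta y - beta a -> coboundary_on beta (F :\ y) -> a != y ->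
  coboundary_on beta F.
Proof.
move=> FD aF yF ay Fy a_y.
have to_a u : u \in F -> psi u a = beta a - beta u.
  move=> uF; have [->|uy] := eqVneq u y; first by rewrite psi_anti ay opprB.
  by apply: Fy; rewrite !inE ?uy ?a_y.
move=> u v uF vF; rewrite (psi_cocycle FD uF aF vF) to_a //.
by rewrite [psi a v]psi_anti to_a // opprB addrC addrA subrK.
Qed.

(* When a facet is added, its intersection with the previous facets is a nonempty
   union of codimension one faces, hence connected. *)
Lemma shellable_coboundary : shellable D ->
  exists beta, forall x y, [set x; y] \in D -> psi x y = beta y - beta x.
Proof.
case=> _ [Fs FsE shell].
have memF i : (i < size Fs)%N -> nth set0 Fs i \in facets D.
  by move=> /(mem_nth set0); rewrite (perm_mem FsE) mem_enum.
suff /(_ (size Fs) (leqnn _))[beta beta_cb] i : (i <= size Fs)%N ->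
    exists beta, forall j, (j < i)%N -> coboundary_on beta (nth set0 Fs j).
  exists beta => x y /facet_exists[F FD]; rewrite subUset !sub1set => /andP[xF yF].
  have FFs : F \in Fs by rewrite (perm_mem FsE) mem_enum.
  apply: (beta_cb (index F Fs)); rewrite ?index_mem ?nth_index //.
elim: i => [_|i IH iFs]; first by exists (fun=> 0).
have [beta beta_cb] := IH (ltnW iFs).
set F := nth set0 Fs i; have F_facet : F \in facets D by exact: memF.
have FD := facet_face F_facet.
suff [beta' [old new]] : exists beta', (forall j, (j < i)%N ->
    coboundary_on beta' (nth set0 Fs j)) /\ coboundary_on beta' F.
  exists beta' => j; rewrite ltnS leq_eqVlt => /orP[/eqP->|] //; exact: old.
have [i0|i_gt0] := posnP i.
  have [a aF] : exists a, a \in F by apply/card_gt0P; apply: ltn_trans (dim2 F_facet).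
  exists (psi a); split=> [j|x y xF yF]; first by rewrite i0.
  by rewrite (psi_cocycle FD xF aF yF) [psi x a]psi_anti addrC.
have shellF j : (j < i)%N -> exists x l,
    [/\ x \in F, x \notin nth set0 Fs j, (l < i)%N & F :\ x \subset nth set0 Fs l].
  move=> ji; have [|x [l [xF li xl]]] := shell i j; first by rewrite ji.
  exists x, l; move: xF; rewrite inE => /andP[-> ->]; split=> //.
  by rewrite xl setDDr setDv set0U subsetIr.
have [y [l [yF yl li Fyl]]] := shellF 0%N i_gt0.
have Fy_cb : coboundary_on beta (F :\ y).
  by move=> u v uF vF; apply: (beta_cb l li); exact: (subsetP Fyl).
have card_Fy : (1 < #|F :\ y|)%N.
  by have := cardsD1 y F; rewrite yF; have := dim2 F_facet; lia.
(* If [y] lies in an earlier facet, the shelling gives another face [F :\ y'] inside an earlier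
   facet; as [F] has at least three vertices, a third vertex [a] carries the equation to [y].
   Otherwise the value at [y] is free. *)
have [[j [ji yj]]|y_new] := pselect (exists j, (j < i)%N /\ y \in nth set0 Fs j).
  exists beta; split=> //.
  have [y' [l' [y'F y'j l'i Fy'l']]] := shellF j ji.
  have y'y : y' != y by apply: contraNneq y'j => ->.
  have [a] : exists a, a \in F :\ y :\ y'.
    by apply/card_gt0P; move: card_Fy; rewrite (cardsD1 y') !inE y'y y'F.
  rewrite !inE => /and3P[ay' ay aF].
  apply: (coboundary_cone FD aF yF _ Fy_cb ay).
  apply: (beta_cb l' l'i); apply: (subsetP Fy'l'); rewrite !inE ?ay' //.
  by rewrite eq_sym y'y.
have [a] : exists a, a \in F :\ y by apply/card_gt0P; exact: ltnW.
rewrite !inE => /andP[ay aF].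
pose beta' z := if z == y then beta a + psi a y else beta z.
have beta'E z : z != y -> beta' z = beta z by rewrite /beta' => /negPf->.
exists beta'; split=> [j ji u v uj vj|].
  rewrite !beta'E; first exact: (beta_cb j).
    by apply: contra_notN y_new => /eqP <-; exists j.
  by apply: contra_notN y_new => /eqP <-; exists j.
apply: (coboundary_cone FD aF yF _ _ ay).
  by rewrite (beta'E a) // /beta' eqxx addrC addKr.
move=> u v uF vF; rewrite !beta'E; first exact: Fy_cb.
  by move: uF; rewrite !inE => /andP[].
by move: vF; rewrite !inE => /andP[].
Qed.

End ShellableCohomology.

(** * Powers of cycles *)

Section Circulant.
Variables n d : nat.
Hypothesis hd : 2 <= 2 * d <= n.

Local Notation G := (circulant n [pred s | 1 <= s <= d]).
Implicit Types (i j : 'I_n) (F H : {set 'I_n}).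

(** [i - j + (j - i)] is |i - j| in truncated subtraction, which leaves conditions on gaps to linear
    arithmetic. *)
Lemma circulantE i j :
  G i j = (i != j) && ((i - j + (j - i) <= d) || (n <= d + (i - j) + (j - i))).
Proof.
rewrite /circulant inE /=; have [//|ij] := eqVneq i j.
have {}ij : nat_of_ord i <> j by move/val_inj/eqP; rewrite (negPf ij).
have := ltn_ord i; have := ltn_ord j; move: ij; case: i => i /= _; case: j => j /= _.
lia.
Qed.

Lemma pair_Ind i j : ([set i; j] \in Ind G) = ~~ G i j.
Proof.
apply/IndP/idP => [|Gij u v /set2P[]-> /set2P[]->]; rewrite ?circulant_irr //.
  by apply; rewrite !inE eqxx ?orbT.
by rewrite circulant_sym.
Qed.

Lemma set1_Ind i : [set i] \in Ind G.
Proof. by apply/IndP => u v /set1P-> /set1P->; rewrite circulant_irr. Qed.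

Lemma Ind_dim0 F : n <= 2 * d + 1 -> F \in Ind G -> #|F| <= 1.
Proof.
move=> nd /IndP FI; apply/card_le1_eqP => i j iF jF; apply/eqP.
by apply: contraNT (FI i j iF jF) => ij; rewrite circulantE eq_sym ij /=; lia.
Qed.

Lemma Ind_dim1 F : n <= 3 * d + 2 -> F \in Ind G -> #|F| <= 2.
Proof.
move=> nd /IndP FI; rewrite leqNgt; apply/negP => /card_gt2P.
case=> [u [v [w [[uF vF wF] [uv vw wu]]]]].
have := FI u v uF vF; have := FI v w vF wF; have := FI w u wF uF.
rewrite !circulantE uv vw wu /=.
have := ltn_ord u; have := ltn_ord v; have := ltn_ord w; lia.
Qed.

Section Connected.
Hypothesis hn : 2 * d + 3 <= n.

Lemma Ind_no_isolated i : exists2 j, i != j & [set i; j] \in Ind G.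
Proof.
have [ilt|ige] := ltnP (i + d.+1) n.
  exists (Ordinal ilt); last by rewrite pair_Ind circulantE negb_and /=; lia.
  by rewrite -val_eqE /=; lia.
have jlt : i + d.+1 - n < n by have := ltn_ord i; lia.
exists (Ordinal jlt); last by rewrite pair_Ind circulantE negb_and /=; have := ltn_ord i; lia.
by rewrite -val_eqE /=; lia.
Qed.

(* i + d + 2 is independent from both i and i + 1. *)
Lemma Ind_connected : edge_connected (Ind G).
Proof.
move=> W W0 W_closed.
have step i j : j = i.+1 :> nat -> (i \in W) = (j \in W).
  move=> ij; have [l [il jl]] : exists l, [set i; l] \in Ind G /\ [set j; l] \in Ind G.
    have := ltn_ord j; have := ltn_ord i.
    have [lt|ge] := ltnP (i + d.+2) n => ni nj.
      by exists (Ordinal lt); rewrite !pair_Ind !circulantE !negb_and /=; lia.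
    have lt : i + d.+2 - n < n by lia.
    by exists (Ordinal lt); rewrite !pair_Ind !circulantE !negb_and /=; lia.
  apply/idP/idP => [/W_closed-/(_ _ il)|/W_closed-/(_ _ jl)] /W_closed; apply.
    by rewrite setUC.
  by rewrite setUC.
have n_gt0 : 0 < n by lia.
have from0 i : (i \in W) = (Ordinal n_gt0 \in W).
  case: i; elim=> [|i IH] ilt; first by congr (_ \in W); apply: val_inj.
  by rewrite -(IH (ltnW ilt)); apply/esym/step.
case/set0Pn: W0 => i iW; apply/setP => j.
by rewrite inE from0 -(from0 i).
Qed.

End Connected.

Lemma circulant_vertex_decomposable :
  n <= 3 * d + 2 -> n <> 2 * d + 2 -> vertex_decomposable (Ind G).
Proof.
move=> n_le n_neq; have [n_small|n_big] := leqP n (2 * d + 1).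
  suff -> : Ind G = points setT by exact: points_vertex_decomposable.
  apply/setP => F; rewrite [RHS]inE powersetE subsetT /=; apply/idP/idP.
    exact: Ind_dim0.
  move=> /card_le1_eqP F1; apply/IndP => i j iF jF.
  by rewrite (F1 i j iF jF) circulant_irr.
have n_gt0 : 0 < n by lia.
have hn : 2 * d + 3 <= n by lia.
have [j ij fij] := Ind_no_isolated hn (Ordinal n_gt0).
apply: (vertex_decomposable_dim1 _ (Ind_connected hn) ij fij) => F.
exact: Ind_dim1.
Qed.

Lemma circulant_cohen_macaulay (k : fieldType) :
  n <= 3 * d + 2 -> n <> 2 * d + 2 -> cohen_macaulay k G.
Proof.
move=> n_le n_neq; have n_gt0 : 0 < n by lia.
have irr : irreflexive G by exact: circulant_irr.
have [n_small|n_big] := leqP n (2 * d + 1).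
  by apply: cohen_macaulay_dim0 => // F; exact: Ind_dim0.
have hn : 2 * d + 3 <= n by lia.
apply: cohen_macaulay_dim1 => //.
- by move=> F; exact: Ind_dim1.
- exact: Ind_connected.
- exact: Ind_no_isolated.
Qed.

Section BalancedFacet.
Variable s : nat.
Hypotheses (s_gt0 : 0 < s) (s_le : s * d.+1 <= n) (s_ge : n <= s * (2 * d + 1)).

(** Evenly spaced points: consecutive gaps are n / s rounded down or up, hence between d + 1 and 2d
    + 1, and [q s] = n closes the cycle. *)
Let q t := t * n %/ s.

Let q_step t : q t + d.+1 <= q t.+1 <= q t + (2 * d + 1).
Proof.
have qD c : q t + c = (c * s + t * n) %/ s by rewrite divnMDl // addnC.
by rewrite !qD; apply/andP; split; apply: leq_div2r; nia.
Qed.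

Let q_lt t u : t < u -> q t + d.+1 <= q u.
Proof.
elim: u => // u IH; rewrite ltnS leq_eqVlt => /orP[/eqP->|/IH tu].
  by have /andP[] := q_step u.
by have /andP[+ _] := q_step u; lia.
Qed.

Let q_end : q s = n.
Proof. by rewrite /q mulKn. Qed.

(** Gaps of at least d + 1 give independence; in a gap of at most 2d + 1 any further vertex is
    within [d] of one of the two ends. *)
Lemma balanced_facet : exists2 F, F \in facets (Ind G) & #|F| = s.
Proof.
have q0 : q 0 = 0 by rewrite /q div0n.
have q_n (t : 'I_s) : q t < n by have := q_lt (ltn_ord t); rewrite q_end; lia.
pose p t := Ordinal (q_n t); pose F := [set p t | t : 'I_s].
have p_inj : injective p.
  move=> t u /(congr1 val) /= tu; apply: val_inj => /=.
  by case: (ltngtP t u) => // /q_lt; rewrite tu; lia.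
exists F; last by rewrite card_imset // card_ord.
have FI : F \in Ind G.
  apply/IndP => _ _ /imsetP[t _ ->] /imsetP[u _ ->].
  rewrite circulantE negb_and negbK orbC -implybE; apply/implyP => tu.
  apply/eqP/val_inj => /=; move: tu => /=.
  have := q_lt (ltn_ord t); have := q_lt (ltn_ord u); rewrite q_end.
  by case: (ltngtP t u) => [/q_lt|/q_lt|->//]; lia.
apply/facetP; split=> // H /IndP HI FH; apply/eqP; rewrite eqEsubset FH andbT.
apply/subsetP => v vH; apply: contraT => vF.
have ex_t : exists t, v < q t.+1 by exists s.-1; rewrite prednK // q_end.
have [t vt t_min] := ex_minnP ex_t.
have ts : t < s by rewrite -(prednK s_gt0) ltnS t_min // prednK // q_end.
have tv : q t <= v.
  by case: (t) t_min => [|t'] t_min; [rewrite q0 | rewrite leqNgt; apply/negP => /t_min; rewrite ltnn].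
have pH u : p u \in H by apply: (subsetP FH); exact: imset_f.
have clash u : ~~ G v (p u) by exact: HI.
have v_neq u : v != p u by apply: contraNneq vF => ->; exact: imset_f.
have := clash (Ordinal ts); rewrite circulantE v_neq /=.
have /andP[_] := q_step t; have := ltn_ord v.
(* The right end of the last interval is [n], that is, the point 0. *)
have [t's|t's] := ltnP t.+1 s.
  by have := clash (Ordinal t's); rewrite circulantE v_neq /=; lia.
have ts' : t.+1 = s by lia.
have := clash (Ordinal s_gt0); rewrite circulantE v_neq /= q0.
by rewrite ts' q_end in vt *; lia.
Qed.

End BalancedFacet.

(** The sizes are s = floor(n / (d + 1)) and s - 1. The latter requires n <= (s - 1)(2d + 1): for s
    >= 4 this follows from n < (s + 1)(d + 1), and for s = 3 it says n <= 4d + 2, which fails only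
    for n = 4d + 3. *)
Lemma facets_of_distinct_sizes : 3 * d + 3 <= n -> n <> 4 * d + 3 ->
  exists F H, [/\ F \in facets (Ind G), H \in facets (Ind G) & #|F| < #|H|].
Proof.
move=> n_ge n_neq; pose s := n %/ d.+1.
have s3 : 3 <= s by rewrite leq_divRL //; lia.
have s_le : s * d.+1 <= n by exact: leq_trunc_div.
have s_gt : n < s.+1 * d.+1 by exact: ltn_ceil.
have [H HF Hs] : exists2 H, H \in facets (Ind G) & #|H| = s.
  by apply: balanced_facet => //; nia.
have [F FF Fs] : exists2 F, F \in facets (Ind G) & #|F| = s.-1.
  apply: balanced_facet; [lia | nia |].
  have [s_eq|s4] : s = 3 \/ 4 <= s by lia.
    by rewrite s_eq in s_gt s_le *; lia.
  have -> : s = (s - 4) + 4 by lia.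
  have := s_gt; have -> : s = (s - 4) + 4 by lia.
  by rewrite addnS /=; nia.
by exists F, H; rewrite FF HF Fs Hs; split=> //; lia.
Qed.

End Circulant.

Lemma cohen_macaulay_face_bound (k : fieldType) n (e : rel 'I_n) F p :
  irreflexive e -> cohen_macaulay k e -> F \in Ind e ->
  (forall s : seq {mpoly k[n]}, regular_seq (map (@to_edge_ring k n e) s) ->
     {subset s <= @max_ideal k n} -> size s <= p) ->
  #|F| <= p.
Proof.
move=> e_irr [r [[_ krull_max] [[s [sr s_max s_reg]] _]]] FI depth_le.
have Fr : #|F| <= r by apply: krull_max; exact: face_prime_chain.
by rewrite (leq_trans Fr) // -sr depth_le.
Qed.

Lemma card_gt1_other (T : finType) (A : {set T}) (x : T) :
  1 < #|A| -> exists2 y, y \in A & y != x.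
Proof.
case/card_gt1P=> u [v [uA vA uv]]; have [ux|] := eqVneq u x; last by exists u.
by exists v; rewrite // -ux eq_sym.
Qed.

(** * Obstructions for the excluded values of [n] *)

Section Obstructions.
Variables (n d : nat) (k : fieldType).
Hypothesis hd : 2 <= 2 * d <= n.

Local Notation G := (circulant n [pred s | 1 <= s <= d]).
Implicit Types (i j : 'I_n).

Let G_irr : irreflexive G.
Proof. exact: circulant_irr. Qed.

Lemma distinct_sizes_not_pure F H : F \in facets (Ind G) -> H \in facets (Ind G) ->
  #|F| < #|H| -> ~ pure (Ind G).
Proof. by move=> FF HF FH /(_ F H FF HF) E; rewrite E ltnn in FH. Qed.

Lemma distinct_sizes_not_cohen_macaulay F H :
  F \in facets (Ind G) -> H \in facets (Ind G) -> #|F| < #|H| ->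
  ~ cohen_macaulay k G.
Proof.
move=> FF HF FH G_cm; move: FH; rewrite ltnNge => /negP; apply.
apply: (cohen_macaulay_face_bound G_irr G_cm (facet_face HF)) => s.
exact: facet_depth.
Qed.

Section Matching.
Hypothesis hn : n = 2 * d + 2.

Let antipodal i j : ~~ G i j = (i == j) || (i - j + (j - i) == d.+1).
Proof.
rewrite circulantE //; have [//|ij] := eqVneq i j.
by have := ltn_ord i; have := ltn_ord j; lia.
Qed.

Let vtx m (mn : m < 2 * d + 2) : 'I_n := Ordinal (eq_ind_r (fun u => m < u) mn hn).

(** The indicator of the component {0, d + 1} is locally constant but vanishes at the vertex 1,
    hence is a nonzero class in reduced H^0. So the depth is at most 1, while the component is a
    face of size 2. *)
Lemma matching_not_cohen_macaulay : ~ cohen_macaulay k G.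
Proof.
move=> G_cm.
have h0 : 0 < 2 * d + 2 by lia.
have h1 : 1 < 2 * d + 2 by lia.
have h2 : d.+1 < 2 * d + 2 by lia.
pose F := [set vtx h0; vtx h2].
have FI : F \in Ind G by rewrite pair_Ind // antipodal -val_eqE /=; lia.
suff : #|F| <= 1 by rewrite cards2.
pose psi (t : seq 'I_n) : k :=
  if t is [:: i] then ((i == 0 :> nat) || (i == d.+1 :> nat))%:R%R else 0%R.
apply: (cohen_macaulay_face_bound G_irr G_cm FI) => s s_reg s_max.
apply: (cohomology_depth G_irr (psi := psi) s_reg s_max).
  move=> [|i [|j []]] // _ /=; rewrite [X in X \in _](_ : _ = [set i; j]); last first.
    by apply/setP => u; rewrite !inE.
  rewrite pair_Ind // antipodal !mul1r subr0 => ij.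
  suff -> : (i == 0 :> nat) || (i == d.+1 :> nat) = (j == 0 :> nat) || (j == d.+1 :> nat).
    by rewrite subrr.
  case/orP: ij => [/eqP->//|ij].
  by have := ltn_ord i; have := ltn_ord j; lia.
case=> b bP; have bE i : (psi [:: i] = b [::])%R.
  rewrite -bP //= ?mul1r ?subr0 // [X in X \in _](_ : _ = [set i]) ?set1_Ind //.
  by apply/setP => u; rewrite !inE.
have := bE (vtx h0); rewrite -(bE (vtx h1)) /psi /=.
have -> : (1 == d.+1) = false by lia.
by move/eqP; rewrite oner_eq0.
Qed.

(** The second facet of a shelling would share all but one of its vertices with the first, but each
    vertex has a single antipode, so distinct facets are disjoint. *)
Lemma matching_not_shellable : ~ shellable (Ind G).
Proof.
case=> G_pure [Fs FsE shell].
have h0 : 0 < 2 * d + 2 by lia.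
have h1 : 1 < 2 * d + 2 by lia.
have h2 : d.+1 < 2 * d + 2 by lia.
have memF (i : nat) : i < size Fs -> nth set0 Fs i \in facets (Ind G).
  by move=> /(mem_nth set0); rewrite (perm_mem FsE) mem_enum.
have [H HF] : exists2 H, H \in facets (Ind G) & [set vtx h0; vtx h2] \subset H.
  by apply: facet_exists; rewrite pair_Ind // antipodal -val_eqE /=; lia.
move=> H02; have H_card : 1 < #|H|.
  by apply: leq_trans (subset_leq_card H02); rewrite cards2.
have [K KF] : exists2 K, K \in facets (Ind G) & [set vtx h1] \subset K.
  by apply: facet_exists; exact: set1_Ind.
rewrite sub1set => K1.
have HK : H != K.
  apply: contraTneq (facet_face KF) => HK; apply/negP => /IndP/(_ (vtx h0) (vtx h1)).
  rewrite K1 -HK (subsetP H02) ?set21 // antipodal -val_eqE /=.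
  by move=> /(_ isT isT); lia.
have Fs2 : 1 < size Fs.
  rewrite (perm_size FsE) -cardE; apply/card_gt1P.
  by exists H, K.
have [//|x [l []]] := shell 1 0; rewrite ltnS leqn0 inE => /andP[xF0 xF1] /eqP-> F10.
have F0F := memF 0 (ltnW Fs2); have F1F := memF 1 Fs2.
set F0 := nth set0 Fs 0 in xF0 F10 F0F; set F1 := nth set0 Fs 1 in xF1 F10 F1F.
have [u uF1 ux] : exists2 u, u \in F1 & u != x.
  by apply: card_gt1_other; rewrite (G_pure F1 H).
have uF0 : u \in F0.
  by have /setP/(_ u) := F10; rewrite !inE uF1 (negPf ux) andbT => /esym/negbFE.
have [w wF0 wu] : exists2 w, w \in F0 & w != u.
  by apply: card_gt1_other; rewrite (G_pure F0 H).
have := IndP _ _ (facet_face F1F) u x uF1 xF1; rewrite antipodal (negPf ux) /= => ux'.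
have := IndP _ _ (facet_face F0F) u w uF0 wF0.
rewrite antipodal eq_sym (negPf wu) /= => uw'.
case/negP: xF0; rewrite (_ : x = w) //; apply: val_inj => /=.
by have := ltn_ord x; have := ltn_ord w; move: ux' uw'; clear -hn; lia.
Qed.

End Matching.

Section Winding.
Hypothesis hn : n = 4 * d + 3.

(* Sending x to 3x maps the complex to the circle R/nZ: an edge with gap
   g in [d+1, 2d+1] goes to an arc of signed length 3g - n, and the arcs around a
   triangle sum to 0 as its gaps sum to n. Up to a coboundary and a sign, [wind]
   is the pullback of the generator of the first cohomology of the circle. *)
Definition wind (i j : nat) : int :=
  if i < j then if j - i <= 2 * d + 1 then 1%R else 2%R
  else if j < i then if i - j <= 2 * d + 1 then (-1)%R else (-2)%R
  else 0%R.

Let psi i j : k := ((wind i j)%:~R)%R.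

Let wind_anti i j : wind j i = (- wind i j)%R.
Proof. by rewrite /wind; case: ltngtP => //; case: ifP. Qed.

Let wind_cocycle (x y z : 'I_n) F : F \in Ind G -> x \in F -> y \in F -> z \in F ->
  wind x z = (wind x y + wind y z)%R.
Proof.
move=> /IndP FI xF yF zF.
have := FI x y xF yF; have := FI y z yF zF; have := FI x z xF zF.
rewrite !circulantE // -!val_eqE /=.
move: (ltn_ord x) (ltn_ord y) (ltn_ord z) hn.
move: (nat_of_ord x) (nat_of_ord y) (nat_of_ord z) => a b c; clear; rewrite /wind.
case: (ltngtP a b) => ?; case: (ltngtP b c) => ?; case: (ltngtP a c) => ?;
  subst; rewrite ?addr0 ?add0r ?ltnn //; repeat case: ifP; lia.
Qed.

Let vtx m (mn : m < 4 * d + 3) : 'I_n := Ordinal (eq_ind_r (fun u => m < u) mn hn).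

(** The closed walk 0, 2d + 1, 4d + 2, 2d, 3d + 2, 0 has total winding 1 + 1 - 2 + 1 - 2 = -1,
    nonzero in every characteristic, whereas a coboundary sums to 0 around it. *)
Let not_coboundary (beta : 'I_n -> k) :
  ~ (forall i j, ~~ G i j -> psi i j = (beta j - beta i)%R).
Proof.
have h0 : 0 < 4 * d + 3 by lia.
have h1 : 2 * d + 1 < 4 * d + 3 by lia.
have h2 : 4 * d + 2 < 4 * d + 3 by lia.
have h3 : 2 * d < 4 * d + 3 by lia.
have h4 : 3 * d + 2 < 4 * d + 3 by lia.
move=> cb.
have step m m' (hm : m < 4 * d + 3) (hm' : m' < 4 * d + 3) :
    d < m - m' + (m' - m) <= 3 * d + 2 ->
    (beta (vtx hm') = beta (vtx hm) + (wind m m')%:~R)%R.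
  move=> gap; rewrite -[((wind m m')%:~R)%R]/(psi (vtx hm) (vtx hm')) cb.
    by rewrite addrC subrK.
  by rewrite circulantE // -val_eqE /=; lia.
have : (beta (vtx h0) = beta (vtx h4) + (wind (3 * d + 2) 0)%:~R)%R by apply: step; lia.
rewrite (step _ _ h3 h4) ?(step _ _ h2 h3) ?(step _ _ h1 h2) ?(step _ _ h0 h1); try lia.
have -> : wind 0 (2 * d + 1) = 1%R by rewrite /wind; repeat case: ifP; lia.
have -> : wind (2 * d + 1) (4 * d + 2) = 1%R by rewrite /wind; repeat case: ifP; lia.
have -> : wind (4 * d + 2) (2 * d) = (-2)%R by rewrite /wind; repeat case: ifP; lia.
have -> : wind (2 * d) (3 * d + 2) = 1%R by rewrite /wind; repeat case: ifP; lia.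
have -> : wind (3 * d + 2) 0 = (-2)%R by rewrite /wind; repeat case: ifP; lia.
rewrite -!addrA -!intrD -[LHS]addr0 => /addrI/esym/eqP.
by rewrite mulrN1z oppr_eq0 oner_eq0.
Qed.

Let triangle : exists2 F, F \in Ind G & 2 < #|F|.
Proof.
have h0 : 0 < 4 * d + 3 by lia.
have h1 : d.+1 < 4 * d + 3 by lia.
have h2 : 2 * d.+1 < 4 * d + 3 by lia.
exists [set vtx h0; vtx h1; vtx h2]; last first.
  by rewrite setUC cardsU1 cards2 !inE -!val_eqE /=; lia.
apply/IndP => u v.
rewrite !inE => /orP[/orP[]|] /eqP-> /orP[/orP[]|] /eqP->;
by rewrite circulantE // -!val_eqE /=; lia.
Qed.

(** The class of [wind] in H^1 bounds the depth by 2, and the independent triple makes the dimension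
    at least 3. *)
Lemma winding_not_cohen_macaulay : ~ cohen_macaulay k G.
Proof.
have [F FI F3] := triangle; move=> G_cm; move: F3; rewrite ltnNge => /negP; apply.
pose psi' (t : seq 'I_n) : k := if t is [:: i; j] then psi i j else 0%R.
apply: (cohen_macaulay_face_bound G_irr G_cm FI) => s s_reg s_max.
apply: (cohomology_depth G_irr (psi := psi') s_reg s_max).
  move=> [|x [|y [|z []]]] // _ fxyz; rewrite /= !mul1r subr0 /psi.
  rewrite (@wind_cocycle x y z _ fxyz) ?inE ?eqxx ?orbT // intrD.
  by ring.
case=> b bP; apply: (@not_coboundary (fun i => b [:: i])) => i j Gij.
rewrite -[psi i j]/(psi' [:: i; j]) -bP //= ?mul1r ?subr0 //.
rewrite [X in X \in _](_ : _ = [set i; j]) ?pair_Ind //.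
by apply/setP => u; rewrite !inE.
Qed.

Lemma winding_not_shellable : ~ shellable (Ind G).
Proof.
move=> G_shell; have [G_pure _] := G_shell.
have [beta beta_cb] : exists beta : 'I_n -> k, forall i j, [set i; j] \in Ind G ->
    psi i j = (beta j - beta i)%R.
  apply: (shellable_coboundary _ _ _ G_shell).
  - have [F /facet_exists[H HF FH] F3] := triangle.
    move=> K KF; rewrite (G_pure K H) //.
    exact: leq_trans F3 (subset_leq_card FH).
  - by move=> x y; rewrite /psi wind_anti intrN.
  - by move=> x y z F FI xF yF zF; rewrite /psi (wind_cocycle FI xF yF zF) intrD.
apply: (@not_coboundary beta) => i j Gij.
by apply: beta_cb; rewrite pair_Ind.
Qed.

End Winding.
End Obstructions.

Theorem theorem3p4 (k : fieldType) (n d : nat) (hd : 2 <= 2 * d <= n) :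
  let G := circulant n [pred s | 1 <= s <= d] in
  [<-> cohen_macaulay k G;
       shellable (Ind G);
       vertex_decomposable (Ind G);
       n <= 3 * d + 2 /\ n <> 2 * d + 2].
Proof.
move=> G.
have iv_vd : n <= 3 * d + 2 /\ n <> 2 * d + 2 -> vertex_decomposable (Ind G).
  by case=> n_le n_neq; exact: circulant_vertex_decomposable.
have shell_iv : shellable (Ind G) -> n <= 3 * d + 2 /\ n <> 2 * d + 2.
  move=> G_shell; have G_pure := G_shell.1.
  split=> [|hn]; last exact: (matching_not_shellable hd hn G_shell).
  rewrite leqNgt; apply/negP => n_gt.
  have [hn|n_neq] := eqVneq n (4 * d + 3); first exact: (winding_not_shellable k hd hn G_shell).
  have [|F [H [FF HF FH]]] := @facets_of_distinct_sizes n d hd _ (elimN eqP n_neq).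
    by lia.
  exact: distinct_sizes_not_pure FF HF FH G_pure.
have cm_iv : cohen_macaulay k G -> n <= 3 * d + 2 /\ n <> 2 * d + 2.
  move=> G_cm.
  split=> [|hn]; last exact: (matching_not_cohen_macaulay hd hn G_cm).
  rewrite leqNgt; apply/negP => n_gt.
  have [hn|n_neq] := eqVneq n (4 * d + 3); first exact: (winding_not_cohen_macaulay hd hn G_cm).
  have [|F [H [FF HF FH]]] := @facets_of_distinct_sizes n d hd _ (elimN eqP n_neq).
    by lia.
  exact: distinct_sizes_not_cohen_macaulay FF HF FH G_cm.
have vd_shellable : vertex_decomposable (Ind G) -> shellable (Ind G).
  exact/vertex_decomposable_shellable/Ind_complex.
(* Condition (iv) is the hub: the obstructions derive it from (i) and from (ii), and it yields (i)
   and (iii) by direct constructions. *)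
tfae.
- by move=> /cm_iv/iv_vd/vd_shellable.
- by move=> /shell_iv/iv_vd.
- by move=> /vd_shellable/shell_iv.
- by case=> n_le n_neq; exact: circulant_cohen_macaulay.
Qed.
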